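(* Let $0<q<1$, let $n\ge1$, let $a_1,\dots,a_n$ be non-negative integers, and put $|A|=\sum_ja_j$, $A^k=\sum_{j>k}a_j$. Let $\sigma\in S_n$ and let $\gamma\in\mathbb R_{>0}^n$ be given by $$\gamma_{\sigma(k)}=q^{\,(k-1)+A^{\sigma(k)}+\#\{j<k\,:\,\sigma(j)>\sigma(k)\}},\qquad k=1,\dots,n,$$ and let $\tilde\gamma_k=q^{A^k}\gamma_k$ for all $k$. Then the weak braided Fourier transform satisfies $$F''(\sigma,\gamma)\big(E_{q^4}(-q^4x_n^2)\,h_{a_n}(x_n;q^2)\cdots E_{q^4}(-q^4x_1^2)\,h_{a_1}(x_1;q^2)\big)=i^{|A|}\,q^{\sum_j(a_j^2-a_j)}\ I''_{(\sigma,\tilde\gamma)}\Big(E_{q^4}\big(-q^4\textstyle\sum_jx_j^2\big)\Big)\ \prod_{j=n}^{1}\partial_j^{a_j}\,e_{q^4}(-\partial_j^2)$$ in $\mathcal D$, where on the left the factors are in decreasing order of the index and on the right the product is taken in decreasing order of $j$ (factor $j=n$ leftmost).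
   Context: Algebras. $\mathcal A$ is the complex algebra of formal power series in $x_1,\dots,x_n$ with relations $x_ix_j=q\,x_jx_i$ for $i>j$; every element is uniquely $\sum_{e}c_e\,x_1^{e_1}\cdots x_n^{e_n}$. $\mathcal D$ is the complex algebra of formal power series in $\partial_1,\dots,\partial_n$ with relations $\partial_i\partial_j=q\,\partial_j\partial_i$ for $i<j$; every element is uniquely $\sum_e c_e\,\partial_n^{e_n}\cdots\partial_1^{e_1}$. For $f=\sum_e c_e x_1^{e_1}\cdots x_n^{e_n}\in\mathcal A$ put $f_{\cdot1}(z)=\sum_e c_ez_1^{e_1}\cdots z_n^{e_n}$ (commuting variables). $q$-notation. $(a;p)_k=\prod_{l=0}^{k-1}(1-ap^l)$; $e_p(z)=\sum_{k\ge0}z^k/(p;p)_k$; $E_p(z)=\sum_{k\ge0}p^{k(k-1)/2}z^k/(p;p)_k$ (in $\mathcal A$ one has $E_{q^4}(-q^4\sum_jx_j^2)=E_{q^4}(-q^4x_n^2)\cdots E_{q^4}(-q^4x_1^2)$); discrete $q^2$-Hermite I polynomials $$h_l(z;q^2)=(q^2;q^2)_l\sum_{k=0}^{\lfloor l/2\rfloor}\frac{(-1)^kq^{2k(k-1)}z^{l-2k}}{(q^4;q^4)_k\,(q^2;q^2)_{l-2k}} .$$ Lattice order integral. Let $\sigma\in S_n$, $\gamma\in\mathbb R_{>0}^n$. For a power series $\varphi$ in commuting variables $z_i$, $i\in S\subseteq\{1,\dots,n\}$, and $l\in S$, let $\varphi^{ev}$ be the part of $\varphi$ with all exponents even, and define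 the function $\int_l\varphi$ of the variables $z_i$, $i\in S\setminus\{l\}$, by $$\Big(\int_l\varphi\Big)(z)=(1-q^2)\sum_{h\in\mathbb Z}\ \sum_{\varepsilon=\pm1}q^{2h}\gamma_l\ \varphi^{ev}(w),\qquad w_i=q^{-1}z_i\ (i<l),\quad w_l=\varepsilon q^{2h}\gamma_l,\quad w_i=z_i\ (i>l)$$ (with $\varphi^{ev}$ analytically extended where needed). An element $f\in\mathcal A$ with $f_{\cdot1}$ absolutely convergent near $0$ is lattice order integrable for $(\sigma,\gamma)$ if, setting $\varphi_0=f_{\cdot1}$ and $\varphi_k=\int_{\sigma(k)}\varphi_{k-1}$, each $\varphi_k$ ($k=1,\dots,n$) is given by an absolutely convergent series and is an entire function of the remaining variables; then $I''_{(\sigma,\gamma)}f:=\varphi_n\in\mathbb C$. Weak transform. If $f\,x_1^{e_1}\cdots x_n^{e_n}$ is lattice order integrable for $(\sigma,\gamma)$ for all $e\in\mathbb Z_{\ge0}^n$, then, with $|E|=\sum_je_j$, $$F''(\sigma,\gamma)(f)=\sum_{e\in\mathbb Z_{\ge0}^n}I''_{(\sigma,\gamma)}\big(f\,x_1^{e_1}\cdots x_n^{e_n}\big)\ \frac{i^{|E|}\,q^{-\sum_j(j-1)e_j}}{\prod_j(q^2;q^2)_{e_j}}\ \partial_n^{e_n}\cdots\partial_1^{e_1}\in\mathcal D .$$ *)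

(* Defs.v *)
From HB Require Import structures.
From mathcomp Require Import all_boot all_order all_algebra all_fingroup.
From mathcomp Require Import complex.
From mathcomp Require Import all_classical all_reals all_analysis.

Set Implicit Arguments.
Unset Strict Implicit.
Unset Printing Implicit Defensive.

Import Order.TTheory GRing.Theory Num.Theory.
Import numFieldNormedType.Exports.

Local Open Scope classical_set_scope.
Local Open Scope ring_scope.
Local Open Scope complex_scope.

Definition expo (n : nat) := {ffun 'I_n -> nat}.

Definition expo_deg n (e : expo n) : nat := (\sum_i e i)%N.

(** The ordered pairs [(d, d')] of exponents with [d + d' = e]. *)
Section Splits.
Variable n : nat.
Implicit Types (d e : expo n).

Definition expo_of N (d : {ffun 'I_n -> 'I_N}) : expo n := [ffun i => d i : nat].

Definition splits (e : expo n) : seq (expo n * expo n) :=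
  [seq x <- [seq (expo_of y.1, expo_of y.2) | y :
               {ffun 'I_n -> 'I_(expo_deg e).+1} * {ffun 'I_n -> 'I_(expo_deg e).+1}]
  | x.1 + x.2 == e].

Lemma expo_of_inj N : injective (@expo_of N).
Proof.
move=> d d' /ffunP dd'; apply/ffunP => i; apply/val_inj.
by have := dd' i; rewrite !ffunE.
Qed.

Lemma leq_expo_deg e i : (e i <= expo_deg e)%N.
Proof. by rewrite /expo_deg (bigD1 i) //= leq_addr. Qed.

Lemma expo_ofP e d : (forall i, d i <= e i)%N ->
  exists d' : {ffun 'I_n -> 'I_(expo_deg e).+1}, expo_of d' = d.
Proof.
move=> de; exists [ffun i => inord (d i)]; apply/ffunP => i.
by rewrite !ffunE inordK // ltnS (leq_trans (de i)) // leq_expo_deg.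
Qed.

Lemma splits_uniq e : uniq (splits e).
Proof.
rewrite filter_uniq // map_inj_uniq ?enum_uniq //.
by move=> [d1 d2] [d1' d2'] /= [] /expo_of_inj-> /expo_of_inj->.
Qed.

Lemma mem_splits e x : (x \in splits e) = (x.1 + x.2 == e).
Proof.
rewrite mem_filter andb_idr // => /eqP xe.
have h1 i : (x.1 i <= e i)%N by rewrite -xe ffunE leq_addr.
have h2 i : (x.2 i <= e i)%N by rewrite -xe ffunE leq_addl.
have [d1 e1] := expo_ofP h1; have [d2 e2] := expo_ofP h2.
by apply/mapP; exists (d1, d2); rewrite ?mem_enum //= e1 e2 -surjective_pairing.
Qed.

End Splits.

(** [twseries p b]: formal power series in generators [X_i] subject to
    [X_i X_j = p X_j X_i] whenever [b i j].  A series is given by its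
    coefficients on normally ordered monomials, so that the product is fixed by
    [X^d * X^e = p ^ (\sum_(i, j | b i j) d_i e_j) X^(d + e)]. *)
Definition twseries (R : realType) (n : nat) (p : R[i]) (b : rel 'I_n) : Type :=
  expo n -> R[i].

Section TwSeries.
Variables (R : realType) (n : nat) (p : R[i]) (b : rel 'I_n).
Implicit Types (d e : expo n).
Local Notation S := (twseries p b).
Implicit Types (f g h : S).

Definition twist d e : nat := (\sum_i \sum_(j | b i j) d i * e j)%N.

HB.instance Definition _ := GRing.Lmodule.copy S (expo n -> R[i]).

Definition mono e : S := fun d => (d == e)%:R.

Definition tw_mul f g : S := fun e =>
  \sum_(x <- splits e) p ^+ twist x.1 x.2 * (f x.1 * g x.2).

Lemma twistDl d d' e : twist (d + d') e = (twist d e + twist d' e)%N.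
Proof.
rewrite /twist -big_split /=; apply: eq_bigr => i _.
by rewrite -big_split /=; apply: eq_bigr => j _; rewrite ffunE mulnDl.
Qed.

Lemma twistDr d e e' : twist d (e + e') = (twist d e + twist d e')%N.
Proof.
rewrite /twist -big_split /=; apply: eq_bigr => i _.
by rewrite -big_split /=; apply: eq_bigr => j _; rewrite ffunE mulnDr.
Qed.

Lemma twist0l e : twist 0 e = 0%N.
Proof. by apply: big1 => i _; apply: big1 => j _; rewrite ffunE mul0n. Qed.

Lemma twist0r e : twist e 0 = 0%N.
Proof. by apply: big1 => i _; apply: big1 => j _; rewrite ffunE muln0. Qed.

Lemma splits_assoc (F : expo n -> expo n -> expo n -> R[i]) e :
  \sum_(x <- splits e) \sum_(y <- splits x.1) F y.1 y.2 x.2 =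
  \sum_(x <- splits e) \sum_(y <- splits x.2) F x.1 y.1 y.2.
Proof.
pose G (t : expo n * expo n * expo n) := F t.1.1 t.1.2 t.2.
pose s1 := [seq (y.1, y.2, x.2) | x <- splits e, y <- splits x.1].
pose s2 := [seq (x.1, y.1, y.2) | x <- splits e, y <- splits x.2].
transitivity (\sum_(t <- s1) G t); first by rewrite big_allpairs_dep.
transitivity (\sum_(t <- s2) G t); last by rewrite big_allpairs_dep.
apply: perm_big; apply: uniq_perm.
- apply: allpairs_uniq_dep; [exact: splits_uniq|by move=> *; exact: splits_uniq|].
  move=> t t' /allpairsPdep[[u1 u2] [[v1 v2] [_ + ->]]].
  rewrite mem_splits => /eqP /= <-.
  move=> /allpairsPdep[[w1 w2] [[y1 y2] [_ + ->]]] /=.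
  by rewrite mem_splits => /eqP /= <- [-> -> ->].
- apply: allpairs_uniq_dep; [exact: splits_uniq|by move=> *; exact: splits_uniq|].
  move=> t t' /allpairsPdep[[u1 u2] [[v1 v2] [_ + ->]]].
  rewrite mem_splits => /eqP /= <-.
  move=> /allpairsPdep[[w1 w2] [[y1 y2] [_ + ->]]] /=.
  by rewrite mem_splits => /eqP /= <- [-> -> ->].
- move=> t; apply/allpairsPdep/allpairsPdep.
    move=> [x [y [+ + ->]]]; rewrite !mem_splits => /eqP xe /eqP yx.
    exists (y.1, y.2 + x.2), (y.2, x.2); rewrite !mem_splits /=.
    by rewrite addrA yx xe !eqxx.
  move=> [x [y [+ + ->]]]; rewrite !mem_splits => /eqP xe /eqP yx.
  exists (x.1 + y.1, y.2), (x.1, y.1); rewrite !mem_splits /=.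
  by rewrite -addrA yx xe !eqxx.
Qed.

Lemma tw_mulA : associative tw_mul.
Proof.
move=> f g h; apply: funext => e; rewrite /tw_mul; symmetry.
pose F d1 d2 d3 :=
  p ^+ (twist d1 d2 + twist d1 d3 + twist d2 d3) * (f d1 * g d2 * h d3).
transitivity (\sum_(x <- splits e) \sum_(y <- splits x.1) F y.1 y.2 x.2).
  apply: eq_big_seq => x _; rewrite mulr_suml mulr_sumr.
  apply: eq_big_seq => y; rewrite mem_splits => /eqP yx.
  by rewrite /F -yx twistDl !mulrA -exprD addnC !addnA.
rewrite splits_assoc; apply: eq_big_seq => x _; rewrite !mulr_sumr.
apply: eq_big_seq => y; rewrite mem_splits => /eqP yx.
by rewrite /F -yx twistDr (mulrCA (f _)) !mulrA -exprD.
Qed.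

Lemma big_splits1 (F : expo n * expo n -> R[i]) e x :
  x.1 + x.2 = e -> (forall y, y \in splits e -> y != x -> F y = 0) ->
  \sum_(y <- splits e) F y = F x.
Proof.
move=> xe F0; rewrite (bigD1_seq x) ?splits_uniq ?mem_splits ?xe //=.
by rewrite big_seq_cond big1 ?addr0 // => y /andP[]; apply: F0.
Qed.

Lemma tw_mul1l : left_id (mono 0) tw_mul.
Proof.
move=> f; apply: funext => e; rewrite /tw_mul (@big_splits1 _ e (0, e)) ?add0r //=.
  by rewrite twist0l expr0 /mono eqxx !mul1r.
move=> [y1 y2]; rewrite mem_splits /= /mono => /eqP ye.
case: (y1 =P 0) => [y0|_ _]; last by rewrite mul0r mulr0.
by rewrite -ye y0 add0r eqxx.
Qed.

Lemma tw_mul1r : right_id (mono 0) tw_mul.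
Proof.
move=> f; apply: funext => e; rewrite /tw_mul (@big_splits1 _ e (e, 0)) ?addr0 //=.
  by rewrite twist0r expr0 /mono eqxx mulr1 mul1r.
move=> [y1 y2]; rewrite mem_splits /= /mono => /eqP ye.
case: (y2 =P 0) => [y0|_ _]; last by rewrite !mulr0.
by rewrite -ye y0 addr0 eqxx.
Qed.

Lemma tw_mulDl : left_distributive tw_mul +%R.
Proof.
move=> f g h; apply: funext => e; rewrite -[RHS]/(tw_mul f h e + tw_mul g h e).
rewrite /tw_mul -big_split; apply: eq_bigr => x _ /=.
by rewrite -[(f + g) _]/(f x.1 + g x.1) mulrDl mulrDr.
Qed.

Lemma tw_mulDr : right_distributive tw_mul +%R.
Proof.
move=> f g h; apply: funext => e; rewrite -[RHS]/(tw_mul f g e + tw_mul f h e).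
rewrite /tw_mul -big_split; apply: eq_bigr => x _ /=.
by rewrite -[(g + h) _]/(g x.2 + h x.2) !mulrDr.
Qed.

Lemma tw_1_neq0 : mono 0 != 0.
Proof.
apply/eqP => /(congr1 (fun f : S => f 0)); rewrite /mono eqxx => /eqP.
by rewrite oner_eq0.
Qed.

HB.instance Definition _ := GRing.Zmodule_isNzRing.Build S
  tw_mulA tw_mul1l tw_mul1r tw_mulDl tw_mulDr tw_1_neq0.

Lemma tw_scalerAl (c : R[i]) f g : c *: (f * g) = (c *: f) * g.
Proof.
apply: funext => e; rewrite /GRing.mul/= /tw_mul [LHS]mulr_sumr.
by apply: eq_bigr => x _; rewrite -[(c *: f) _]/(c * f x.1) mulrCA (mulrA c).
Qed.

HB.instance Definition _ := GRing.Lmodule_isLalgebra.Build R[i] S tw_scalerAl.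

Lemma tw_scalerAr (c : R[i]) f g : c *: (f * g) = f * (c *: g).
Proof.
apply: funext => e; rewrite /GRing.mul/= /tw_mul [LHS]mulr_sumr.
by apply: eq_bigr => x _; rewrite -[(c *: g) _]/(c * g x.2) mulrCA (mulrCA c).
Qed.

HB.instance Definition _ := GRing.Lalgebra_isAlgebra.Build R[i] S tw_scalerAr.

Definition expo1 (i : 'I_n) : expo n := [ffun j => (j == i) : nat].

Definition gen (i : 'I_n) : S := mono (expo1 i).

(** [g(f) = \sum_k g_k f^k] for [f] without constant term: the monomials of
    [f^k] then have total degree at least [k], so the terms with
    [k > expo_deg e] do not contribute to the coefficient of [e]. *)
Definition series_at (g : nat -> R[i]) (f : S) : S := fun e =>
  \sum_(k < (expo_deg e).+1) g k * (f ^+ k) e.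

Lemma monoM d e : mono d * mono e = p ^+ twist d e *: mono (d + e).
Proof.
apply: funext => u; rewrite /GRing.mul/= /tw_mul.
rewrite -[RHS]/(p ^+ twist d e * (u == d + e)%:R).
have [->|ude] := eqVneq u (d + e).
  rewrite (@big_splits1 _ (d + e) (d, e)) //= /mono ?eqxx ?mulr1 //.
  move=> [y1 y2] _; rewrite xpair_eqE negb_and /=.
  by case/orP => /negbTE->; rewrite ?mul0r !mulr0.
rewrite mulr0 big_seq big1 // => -[y1 y2]; rewrite mem_splits /mono /= => /eqP yu.
have [y1d|] := eqVneq y1 d; last by rewrite mul0r mulr0.
have [y2e|] := eqVneq y2 e; last by rewrite !mulr0.
by rewrite -yu y1d y2e eqxx in ude.
Qed.

Lemma twist_expo1 i j : twist (expo1 i) (expo1 j) = b i j.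
Proof.
rewrite /twist (bigD1 i) //= [X in (_ + X)%N]big1 ?addn0; last first.
  by move=> k /negbTE ki; apply: big1 => l _; rewrite ffunE ki.
under eq_bigr do rewrite !ffunE eqxx mul1n.
case bij: (b i j).
  by rewrite (bigD1 j) //= eqxx big1 // => k /andP[_ /negbTE->].
by rewrite big1 // => k bik; case: eqP => // kj; rewrite -kj bik in bij.
Qed.

Lemma gen_comm i j : b i j -> ~~ b j i -> gen i * gen j = p *: (gen j * gen i).
Proof.
move=> bij bji; rewrite !monoM !twist_expo1 bij (negbTE bji) expr0 expr1 scale1r.
by rewrite addrC.
Qed.

End TwSeries.

Arguments mono {R n p b}.
Arguments gen {R n p b}.

(** Normally ordered monomials are the basis [mono]. *)
Section NormalOrder.
Variables (R : realType) (n : nat) (p : R[i]) (b : rel 'I_n).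

Lemma genX i k : irreflexive b ->
  gen i ^+ k = mono [ffun j => if j == i then k else 0%N] :> twseries p b.
Proof.
move=> b_irr; elim: k => [|k IH].
  by rewrite expr0; congr mono; apply/ffunP => j; rewrite !ffunE if_same.
rewrite exprS IH monoM.
have -> : twist b (expo1 i) [ffun j => if j == i then k else 0%N] = 0%N.
  apply: big1 => j _; apply: big1 => l bjl; rewrite !ffunE.
  case: (j =P i) => // ji; case: (l =P i) => // li.
  by rewrite ji li b_irr in bjl.
rewrite expr0 scale1r; congr mono; apply/ffunP => j; rewrite !ffunE.
by case: eqP.
Qed.

Lemma prod_gen (s : seq 'I_n) (e : expo n) :
  irreflexive b -> uniq s -> pairwise (fun i j => ~~ b i j) s ->
  \prod_(j <- s) gen j ^+ e j = mono [ffun j => if j \in s then e j else 0%N]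
  :> twseries p b.
Proof.
move=> b_irr; elim: s => [_ _|i s IH /= /andP[nis us] /andP[/allP bi ps]].
  by rewrite big_nil; congr mono; apply/ffunP => j; rewrite !ffunE.
rewrite big_cons IH // genX // monoM.
rewrite (_ : twist _ _ _ = 0%N) ?expr0 ?scale1r; last first.
  apply: big1 => j _; apply: big1 => l bjl; rewrite !ffunE.
  case: (j =P i) => // ji; case: ifP => [ls|]; last by rewrite muln0.
  by have := bi _ ls; rewrite -ji bjl.
congr mono; apply/ffunP => j; rewrite !ffunE in_cons.
case: (j =P i) => [->|_]; last by rewrite add0r.
by rewrite (negbTE nis) addr0.
Qed.

End NormalOrder.

(** [x_i x_j = q x_j x_i] for [i > j]; coefficients on [x_1^e_1 ... x_n^e_n]. *)
Notation qA q n := (@twseries _ n (q%:C) (fun i j : 'I_n => (j < i)%N)).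

(** [d_i d_j = q d_j d_i] for [i < j]; coefficients on [d_n^e_n ... d_1^e_1]. *)
Notation qD q n := (@twseries _ n (q%:C) (fun i j : 'I_n => (i < j)%N)).

Lemma qA_normal (R : realType) (q : R) (n : nat) (e : expo n) :
  \prod_(j < n) gen j ^+ e j = mono e :> qA q n.
Proof.
rewrite (@prod_gen _ _ _ _ (index_enum 'I_n)).
- by congr mono; apply/ffunP => j; rewrite ffunE mem_index_enum.
- by move=> i; rewrite ltnn.
- exact: index_enum_uniq.
- rewrite /index_enum -enumT.
  have : pairwise ltn (map val (enum 'I_n)).
    by rewrite val_enum_ord -sorted_pairwise ?iota_ltn_sorted //; exact: ltn_trans.
  by rewrite pairwise_map; apply: sub_pairwise => i j /= ij; rewrite -leqNgt ltnW.
Qed.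

Lemma qD_normal (R : realType) (q : R) (n : nat) (e : expo n) :
  \prod_(j < n) gen (rev_ord j) ^+ e (rev_ord j) = mono e :> qD q n.
Proof.
rewrite -(big_map (@rev_ord n) predT (fun j => gen j ^+ e j)).
rewrite prod_gen.
- congr mono; apply/ffunP => j; rewrite ffunE ifT //.
  by apply/mapP; exists (rev_ord j); rewrite ?mem_index_enum ?rev_ordK.
- by move=> i; rewrite ltnn.
- by rewrite map_inj_uniq ?index_enum_uniq //; exact: rev_ord_inj.
- rewrite pairwise_map /index_enum -enumT.
  have : pairwise ltn (map val (enum 'I_n)).
    by rewrite val_enum_ord -sorted_pairwise ?iota_ltn_sorted //; exact: ltn_trans.
  rewrite pairwise_map; apply: sub_pairwise => i j /= ij.
  by rewrite -leqNgt leq_sub2l // ltnW.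
Qed.

Section QNotation.
Variable F : fieldType.

Definition qpoch (a p : F) (k : nat) : F := \prod_(l < k) (1 - a * p ^+ l).

Definition e_coef (p : F) (k : nat) : F := (qpoch p p k)^-1.

Definition E_coef (p : F) (k : nat) : F :=
  p ^+ (k * k.-1)./2 / qpoch p p k.

(** The discrete Hermite I polynomial [h_l(z; q^2)], as a function of [q]. *)
Definition dHermite (A : algType F) (q : F) (l : nat) (z : A) : A :=
  qpoch (q ^+ 2) (q ^+ 2) l *:
  \sum_(k < l./2.+1)
    ((-1) ^+ k * q ^+ (2 * (k * k.-1)) /
     (qpoch (q ^+ 4) (q ^+ 4) k * qpoch (q ^+ 2) (q ^+ 2) (l - 2 * k)))
    *: z ^+ (l - 2 * k).

End QNotation.

(** Unordered absolutely convergent sums of complex numbers. *)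
Section ComplexSum.
Variables (R : realType) (I : choiceType).

Definition abs_summable (u : I -> R[i]) : Prop :=
  summable setT (fun i => (ComplexField.Normc.normc (u i))%:E).

Definition rsum (u : I -> R) : R :=
  fine (\esum_(i in setT) (Num.max (u i) 0)%:E) -
  fine (\esum_(i in setT) (Num.max (- u i) 0)%:E).

Definition csum (u : I -> R[i]) : R[i] :=
  rsum (fun i => complex.Re (u i)) +i* rsum (fun i => complex.Im (u i)).

Definition has_sum (u : I -> R[i]) (s : R[i]) : Prop :=
  abs_summable u /\ s = csum u.

End ComplexSum.

(** Commutative power series, given by their coefficients; a series in the
    variables [z_i], [i \in S], is one whose coefficients vanish at exponents
    not supported in [S]. *)
Section CommutativeSeries.
Variables (R : realType) (n : nat).
Local Notation C := R[i].
Implicit Types (c : expo n -> C) (z w : 'rV[C]_n).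

Definition series_term c z (e : expo n) : C := c e * \prod_i z 0 i ^+ e i.

Definition polydisc (r : R) : set 'rV[C]_n :=
  [set z | forall i, ComplexField.Normc.normc (z 0 i) < r].

Definition convergent_near0 c : Prop :=
  exists2 r : R, 0 < r & forall z, polydisc r z -> abs_summable (series_term c z).

Definition entire_series c : Prop := forall z, abs_summable (series_term c z).

Definition even_part c : expo n -> C :=
  fun e => if [forall i, ~~ odd (e i)] then c e else 0.

Definition analytic_on (U : set 'rV[C]_n) (G : 'rV[C]_n -> C) : Prop :=
  forall w, U w -> exists (d : expo n -> C) (r : R), 0 < r /\
    forall z, polydisc r z -> U (w + z) /\ has_sum (series_term d z) (G (w + z)).

(** [G] gives on [W] the values of the series [c], analytically extended if
    needed: either [c] converges on all of [W], or [G] is analytic on a domain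
    containing [0] and [W], and equal to the sum of [c] where [c] converges. *)
Definition extended_values c (W : set 'rV[C]_n) (G : 'rV[C]_n -> C) : Prop :=
  (forall w, W w -> has_sum (series_term c w) (G w)) \/
  exists U : set 'rV[(C : numFieldType)]_n,
    [/\ open U, connected U, U 0, W `<=` U & analytic_on U G] /\
    forall w, U w -> abs_summable (series_term c w) ->
      has_sum (series_term c w) (G w).

End CommutativeSeries.

Section LatticeIntegral.
Variables (R : realType) (n : nat) (q : R).
Local Notation C := R[i].
Implicit Types (g : 'I_n -> R) (s : 'S_n) (phi psi : expo n -> C).

(** The point [w]; [eps = true] stands for the sign [-1]. *)
Definition lattice_point g (l : 'I_n) (z : 'rV[C]_n) (h : int) (eps : bool) :
    'rV[C]_n :=
  \row_i if (i < l)%N then (q^-1)%:C * z 0 i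
         else if i == l then ((-1) ^+ eps * q ^ (2%:Z * h) * g l)%:C
         else z 0 i.

(** [psi] is the power series of the entire function [\int_l phi]. *)
Definition is_partial_integral g (l : 'I_n) phi psi : Prop :=
  entire_series psi /\
  exists2 G : 'rV[C]_n -> C,
    extended_values (even_part phi)
      [set w | exists z h eps, w = lattice_point g l z h eps] G &
    forall z, exists2 t : C,
      has_sum (fun k : int * bool =>
        (q ^ (2%:Z * k.1) * g l)%:C * G (lattice_point g l z k.1 k.2)) t &
      csum (series_term psi z) = (1 - q ^+ 2)%:C * t.

(** [phi k] is the series obtained after [k] integrations, in the variables
    other than [z_(s 0), ..., z_(s (k - 1))]. *)
Definition is_lattice_integral s g (f : qA q n) (v : C) : Prop :=
  convergent_near0 f /\
  exists phi : nat -> expo n -> C,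
    [/\ phi 0%N = f,
        forall k : 'I_n, is_partial_integral g (s k) (phi k) (phi k.+1),
        forall (k : 'I_n) (e : expo n),
          (exists2 j : 'I_n, (j <= k)%N & e (s j) != 0%N) -> phi k.+1 e = 0 &
        v = phi n 0].

Definition lattice_integrable s g (f : qA q n) : Prop :=
  exists v, is_lattice_integral s g f v.

Definition lattice_integral s g (f : qA q n) : C :=
  xget 0 [set v | is_lattice_integral s g f v].

Definition weak_transformable s g (f : qA q n) : Prop :=
  forall e : expo n,
    lattice_integrable s g (f * \prod_(j < n) gen j ^+ e j).

Definition weak_transform s g (f : qA q n) : qD q n := fun e =>
  lattice_integral s g (f * \prod_(j < n) gen j ^+ e j) *
  ('i%C ^+ expo_deg e * (q%:C) ^- (\sum_(j < n) j * e j)%N /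
   \prod_(j < n) qpoch ((q%:C) ^+ 2) ((q%:C) ^+ 2) (e j)).

End LatticeIntegral.

(* Main.v *)
Require Import Defs.
From HB Require Import structures.
From mathcomp Require Import all_boot all_order all_algebra all_fingroup.
From mathcomp Require Import complex.
From mathcomp Require Import all_classical all_reals all_analysis.
From mathcomp Require Import finmap ring lra zify.

Set Implicit Arguments.
Unset Strict Implicit.
Unset Printing Implicit Defensive.

Import Order.TTheory GRing.Theory Num.Theory.

Local Open Scope ring_scope.
Local Open Scope complex_scope.

(** Write [f x^d] in normal order: its coefficient at [e] is a product of
    one-variable coefficients times [q ^ (\sum_(j < i) e_i e_j + \sum_j beta_j e_j)].
    Families of this shape ([gauss_series]) are stable under each lattice
    integration.  Integrating out [z_l] replaces the one-variable series
    [V_l(z_l)] by [V_l(q^N z_l)] with [N = beta_l + \sum_(i != l) e_i]; the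
    exponents [e_i] are even, and the parity of the exponent of [gamma_l] is
    exactly the one that puts [q^N gamma_l] on the lattice [q^(2Z)], on which
    [V_l] vanishes above [1].  So the sum over the lattice may be exchanged with
    the sum over the other exponents, and rescaling it yields the factor [q^(-N)],
    which only changes the linear exponent [beta].

    After [n] steps everything is reduced to the Jackson integrals of
    [z^d E_(q^4)(-q^4 z^2) h_a(z; q^2)].  These follow from the moment recurrence
    given by [E_(q^4)(-z^2) = (1 - z^2) E_(q^4)(-q^4 z^2)] and from the three-term
    recurrence of the discrete Hermite polynomials.

    Since [lattice_integral] is a choice, its value must also be shown unique:
    all series involved are entire, so no analytic extension is ambiguous, and the
    values of the even part of an entire series are determined by the values of
    the series, as an average over sign changes. *)

Local Notation normc := ComplexField.Normc.normc.

(** * Unordered sums *)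

Section NonnegativeSums.
Variable R : realType.
Local Open Scope classical_set_scope.

Definition nsum (I : choiceType) (a : I -> R) : \bar R :=
  (\esum_(i in [set: I]) (a i)%:E)%E.

Variables I J : choiceType.
Implicit Types a b : I -> R.

Lemma nsum_ge0 a : (forall i, 0 <= a i) -> (0 <= nsum a)%E.
Proof. by move=> a0; apply: esum_ge0 => i _; rewrite lee_fin. Qed.

Lemma le_nsum a b : (forall i, a i <= b i) -> (nsum a <= nsum b)%E.
Proof. by move=> ab; apply: le_esum => i _; rewrite lee_fin. Qed.

Lemma nsum_fin a : (forall i, 0 <= a i) -> (nsum a < +oo)%E ->
  (fine (nsum a))%:E = nsum a.
Proof. by move=> a0 aoo; rewrite fineK // ge0_fin_numE // nsum_ge0. Qed.

Lemma nsumD a b : (forall i, 0 <= a i) -> (forall i, 0 <= b i) ->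
  nsum (fun i => a i + b i) = (nsum a + nsum b)%E.
Proof.
move=> a0 b0; rewrite /nsum -esumD; last 2 first.
- by move=> i _; rewrite lee_fin.
- by move=> i _; rewrite lee_fin.
by apply: eq_esum => i _; rewrite EFinD.
Qed.

Lemma nsum_le_bound a (M : R) : (forall i, 0 <= a i) ->
  (forall F : {fset I}, \sum_(i <- F) a i <= M) -> (nsum a <= M%:E)%E.
Proof.
move=> a0 aM; apply: ge_ereal_sup => _ [X [finX _] <-].
rewrite fsbig_finite //= sumEFin lee_fin; exact: aM.
Qed.

Lemma fset_le_nsum a (F : {fset I}) : (forall i, 0 <= a i) ->
  (nsum a < +oo)%E -> \sum_(i <- F) a i <= fine (nsum a).
Proof.
move=> a0 aoo; rewrite -lee_fin nsum_fin //.
apply: esum_ge; exists [set` F]; first by split.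
by rewrite fsbig_finite ?finite_fset //= set_fsetK sumEFin.
Qed.

(** The bound [le1] holds for every factor [c]; applied once to [k] and once to [k^-1] with the
    family [k * a i], it gives both inequalities. *)
Lemma nsumZ (k : R) a : 0 <= k -> (forall i, 0 <= a i) ->
  (nsum a < +oo)%E -> nsum (fun i => k * a i) = (k%:E * nsum a)%E.
Proof.
move=> k0 a0 aoo.
have le1 (c : R) b : 0 <= c -> (forall i, 0 <= b i) -> (nsum b < +oo)%E ->
    (nsum (fun i => c * b i)%R <= c%:E * nsum b)%E.
  move=> c0 b0 boo; rewrite -(nsum_fin b0 boo) -EFinM.
  apply: nsum_le_bound => [i|F]; first exact: mulr_ge0.
  by rewrite -mulr_sumr ler_wpM2l // fset_le_nsum.
apply/eqP; rewrite eq_le le1 //=.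
have [->|kn0] := eqVneq k 0.
  by rewrite mul0e; apply: nsum_ge0 => i; rewrite mul0r.
have kp : 0 < k by rewrite lt_def kn0.
have kaoo : (nsum (fun i => k * a i)%R < +oo)%E.
  by apply: le_lt_trans (le1 _ _ k0 a0 aoo) _; rewrite -(nsum_fin a0 aoo) ltry.
have ka0 i : 0 <= k * a i by rewrite mulr_ge0.
have kV0 : 0 <= k^-1 by rewrite invr_ge0.
have := le1 k^-1 (fun i => k * a i)%R kV0 ka0 kaoo.
have -> : (fun i => k^-1 * (k * a i)) = a.
  by apply: funext => i; rewrite mulrA mulVf // mul1r.
rewrite -(nsum_fin a0 aoo) -(nsum_fin ka0 kaoo) -!EFinM !lee_fin.
by rewrite ler_pdivlMl.
Qed.

(** The basis of all later reindexings: restriction to even exponents, shifts of the lattice, and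
    the splitting of an exponent into one entry and the rest. *)
Lemma nsum_inj (f : J -> I) a : injective f -> (forall i, 0 <= a i) ->
  (forall i, (forall j, f j != i) -> a i = 0) ->
  nsum a = nsum (fun j => a (f j)).
Proof.
move=> finj a0 aout; rewrite /nsum.
rewrite -(esum_image setT f (fun i => (a i)%:E)); last by move=> x y _ _ /finj.
rewrite [RHS]esum_mkcond; apply: eq_esum => i _; case: ifPn => // /negP ni.
rewrite aout // => j; apply/negP => /eqP fji; apply: ni.
by apply: mem_set; exists j.
Qed.

End NonnegativeSums.

Lemma nsum_pair (R : realType) (I J : choiceType) (a : I * J -> R) (r : I -> R) :
  (forall x, 0 <= a x) ->
  (forall i, nsum (fun j => a (i, j)) = (r i)%:E) -> nsum a = nsum r.
Proof.
move=> a0 ar; rewrite /nsum.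
under [in RHS]eq_esum do rewrite -ar.
rewrite esum_esum; last by move=> *; rewrite lee_fin.
have -> : ([set: I] `*`` (fun=> [set: J]) = [set: I * J])%classic.
  by apply/seteqP; split.
by apply: eq_esum => -[].
Qed.

Lemma nsum_pair_row (R : realType) (I J : choiceType) (a : I * J -> R) i : (forall x, 0 <= a x) ->
  (nsum a < +oo)%E -> (nsum (fun j => a (i, j)) < +oo)%E.
Proof.
move=> a0 aoo; apply: le_lt_trans (aoo).
rewrite -(nsum_fin a0 aoo); apply: nsum_le_bound => // F.
pose G := [fset (i, j) | j in F]%fset.
have -> : \sum_(j <- F) a (i, j) = \sum_(x <- G) a x.
  rewrite /G big_imfset //=; last by move=> x y _ _ [].
by apply: fset_le_nsum.
Qed.

Section RealSums.
Variable R : realType.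
Variables I J : choiceType.
Implicit Types u v : I -> R.
Local Notation rsummable u := (nsum (fun i => `|u i|%R) < +oo)%E.

(** [rsum] uses the positive part $p$ and the negative part $m$ of $u$. For any other decomposition
    $u = a - b$ one has $p + b = m + a$ termwise, and all four sums are finite. *)
Lemma rsum_sub (a b u : I -> R) : (forall i, 0 <= a i) -> (forall i, 0 <= b i) ->
  (nsum a < +oo)%E -> (nsum b < +oo)%E -> (forall i, u i = a i - b i) ->
  rsum u = fine (nsum a) - fine (nsum b).
Proof.
move=> a0 b0 aoo boo uab.
pose p i := Num.max (u i) 0; pose m i := Num.max (- u i) 0.
have p0 i : 0 <= p i by rewrite le_max lexx orbT.
have m0 i : 0 <= m i by rewrite le_max lexx orbT.
have poo : (nsum p < +oo)%E.
  apply: le_lt_trans aoo; apply: le_nsum => i.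
  by rewrite ge_max a0 uab lerBlDr lerDl b0.
have moo : (nsum m < +oo)%E.
  apply: le_lt_trans boo; apply: le_nsum => i.
  by rewrite ge_max b0 uab opprB lerBlDr lerDl a0.
have : (nsum p + nsum b = nsum m + nsum a)%E.
  rewrite -!nsumD //; congr nsum; apply: funext => i.
  rewrite /p /m uab; case/orP: (le_total 0 (a i - b i)) => ?.
    by rewrite max_l // max_r ?oppr_le0 //; ring.
  by rewrite max_r // max_l ?oppr_ge0 //; ring.
rewrite -(nsum_fin p0 poo) -(nsum_fin m0 moo) -(nsum_fin a0 aoo).
rewrite -(nsum_fin b0 boo) -!EFinD /= => -[].
rewrite -[rsum u]/(fine (nsum p) - fine (nsum m)) => e.
by apply/eqP; rewrite subr_eq addrAC eq_sym subr_eq e addrC.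
Qed.

Let pos u i : R := Num.max (u i) 0.
Let neg u i : R := Num.max (- u i) 0.

Let pos_ge0 u i : 0 <= pos u i. Proof. by rewrite le_max lexx orbT. Qed.
Let neg_ge0 u i : 0 <= neg u i. Proof. by rewrite le_max lexx orbT. Qed.

Let pos_fin u : rsummable u -> (nsum (pos u) < +oo)%E.
Proof.
by apply: le_lt_trans; apply: le_nsum => i; rewrite ge_max normr_ge0 ler_norm.
Qed.

Let neg_fin u : rsummable u -> (nsum (neg u) < +oo)%E.
Proof.
by apply: le_lt_trans; apply: le_nsum => i; rewrite ge_max normr_ge0 ler_normr lexx orbT.
Qed.

Let pos_num u : rsummable u -> nsum (pos u) \is a fin_num.
Proof. by move=> su; rewrite ge0_fin_numE; [exact: pos_fin|exact: nsum_ge0]. Qed.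

Let neg_num u : rsummable u -> nsum (neg u) \is a fin_num.
Proof. by move=> su; rewrite ge0_fin_numE; [exact: neg_fin|exact: nsum_ge0]. Qed.

Let posB u i : u i = pos u i - neg u i.
Proof.
rewrite /pos /neg; case/orP: (le_total 0 (u i)) => ?.
  by rewrite max_l // max_r ?oppr_le0 // subr0.
by rewrite max_r // max_l ?oppr_ge0 // sub0r opprK.
Qed.

Lemma rsumD u v : rsummable u -> rsummable v ->
  rsum (fun i => u i + v i) = rsum u + rsum v.
Proof.
move=> su sv.
rewrite (@rsum_sub (fun i => pos u i + pos v i) (fun i => neg u i + neg v i)).
- rewrite !nsumD // (fineD (pos_num su) (pos_num sv)) (fineD (neg_num su) (neg_num sv)).
  by rewrite opprD addrACA.
- by move=> i; rewrite addr_ge0.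
- by move=> i; rewrite addr_ge0.
- by rewrite nsumD // lte_add_pinfty //; exact: pos_fin.
- by rewrite nsumD // lte_add_pinfty //; exact: neg_fin.
- by move=> i; rewrite {1}(posB u) {1}(posB v); ring.
Qed.

Lemma rsumN u : rsum (fun i => - u i) = - rsum u.
Proof.
by rewrite /rsum opprB; congr (_ - fine _); apply: eq_esum => i _; rewrite opprK.
Qed.

Lemma rsumZ k u : rsummable u -> rsum (fun i => k * u i) = k * rsum u.
Proof.
move=> su; wlog k0 : k / 0 <= k => [hw|].
  case: (leP 0 k) => [|/ltW kn]; first exact: hw.
  have := hw (- k); rewrite oppr_ge0 => /(_ kn) e.
  rewrite -[LHS]opprK -rsumN mulrC -[RHS]opprK -mulrN mulrC -e.
  by congr (- _); congr rsum; apply: funext => i; rewrite mulNr.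
rewrite (@rsum_sub (fun i => k * pos u i) (fun i => k * neg u i)).
- rewrite (nsumZ k0 (pos_ge0 u) (pos_fin su)) (nsumZ k0 (neg_ge0 u) (neg_fin su)).
  by rewrite (fineM _ (pos_num su)) // (fineM _ (neg_num su)) // -mulrBr.
- by move=> i; rewrite mulr_ge0.
- by move=> i; rewrite mulr_ge0.
- by rewrite (nsumZ k0 (pos_ge0 u) (pos_fin su)) -(nsum_fin (pos_ge0 u) (pos_fin su)) -EFinM ltry.
- by rewrite (nsumZ k0 (neg_ge0 u) (neg_fin su)) -(nsum_fin (neg_ge0 u) (neg_fin su)) -EFinM ltry.
- by move=> i; rewrite {1}(posB u); ring.
Qed.

Lemma rsum_inj (f : J -> I) u : injective f ->
  (forall i, (forall j, f j != i) -> u i = 0) ->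
  rsum u = rsum (fun j => u (f j)).
Proof.
move=> finj uout; rewrite /rsum -/(nsum (pos u)) -/(nsum (neg u)).
by congr (fine _ - fine _); apply: nsum_inj => // i /uout ui;
  rewrite /pos /neg ui ?oppr0 maxxx.
Qed.

End RealSums.

(** The row sums [P] and [N] of the positive and negative parts need not be the positive and
    negative parts of the row sums of [u]; [rsum_sub] accepts them all the same. *)
Lemma rsum_pair (R : realType) (I J : choiceType) (u : I * J -> R) :
  (nsum (fun x => `|u x|%R) < +oo)%E ->
  rsum u = rsum (fun i => rsum (fun j => u (i, j))).
Proof.
move=> su.
pose pos x := Num.max (u x) 0; pose neg x := Num.max (- u x) 0.
have pos_ge0 x : 0 <= pos x by rewrite le_max lexx orbT.
have neg_ge0 x : 0 <= neg x by rewrite le_max lexx orbT.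
have pos_fin : (nsum pos < +oo)%E.
  by apply: le_lt_trans su; apply: le_nsum => i; rewrite ge_max normr_ge0 ler_norm.
have neg_fin : (nsum neg < +oo)%E.
  by apply: le_lt_trans su; apply: le_nsum => i; rewrite ge_max normr_ge0 ler_normr lexx orbT.
pose P i := fine (nsum (fun j => pos (i, j))).
pose N i := fine (nsum (fun j => neg (i, j))).
have PE : nsum pos = nsum P.
  apply: nsum_pair => // i; rewrite /P nsum_fin //; exact: nsum_pair_row.
have NE : nsum neg = nsum N.
  apply: nsum_pair => // i; rewrite /N nsum_fin //; exact: nsum_pair_row.
rewrite (@rsum_sub _ _ P N).
- by rewrite -PE -NE.
- by move=> i; rewrite fine_ge0 // nsum_ge0.
- by move=> i; rewrite fine_ge0 // nsum_ge0.
- by rewrite -PE.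
- by rewrite -NE.
- by [].
Qed.

(** * Moduli and unordered sums of complex numbers *)

Section NormC.
Variable R : realType.
Implicit Types x y : R[i].

Lemma normc_ge0 x : 0 <= normc x.
Proof. by case: x => a b; rewrite /normc sqrtr_ge0. Qed.

Lemma normRe_le x : `|complex.Re x| <= normc x.
Proof. by case: x => a b; rewrite /normc /= -sqrtr_sqr ler_wsqrtr // lerDl sqr_ge0. Qed.

Lemma normIm_le x : `|complex.Im x| <= normc x.
Proof. by case: x => a b; rewrite /normc /= -sqrtr_sqr ler_wsqrtr // lerDr sqr_ge0. Qed.

Lemma normc_real (a : R) : normc a%:C = `|a|.
Proof. by rewrite /normc /= expr0n /= addr0 sqrtr_sqr. Qed.

Lemma le_normc_ReIm x : normc x <= `|complex.Re x| + `|complex.Im x|.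
Proof.
case: x => a b; rewrite /normc /=.
rewrite -[leRHS]ger0_norm ?addr_ge0 // -sqrtr_sqr ler_wsqrtr //.
rewrite -(real_normK (num_real a)) -(real_normK (num_real b)) sqrrD.
by rewrite [leRHS]addrAC lerDl mulrn_wge0 // mulr_ge0.
Qed.

Lemma normcX x k : normc (x ^+ k) = normc x ^+ k.
Proof.
by elim: k => [|k IH]; rewrite ?expr0 ?ComplexField.Normc.normc1 // !exprS
  ComplexField.Normc.normcM IH.
Qed.

Lemma normc_prod (I : Type) (r : seq I) (P : pred I) (F : I -> R[i]) :
  normc (\prod_(i <- r | P i) F i) = \prod_(i <- r | P i) normc (F i).
Proof.
exact: (big_morph _ (@ComplexField.Normc.normcM R) (@ComplexField.Normc.normc1 R)).
Qed.

End NormC.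

Section ComplexSums.
Variables (R : realType) (I : choiceType).
Implicit Types (u v : I -> R[i]) (s t : R[i]).

Lemma abs_summableE u : abs_summable u <-> (nsum (fun i => normc (u i)) < +oo)%E.
Proof.
rewrite /abs_summable /summable /nsum.
by under eq_esum do rewrite gee0_abs ?lee_fin ?normc_ge0 //.
Qed.

Lemma abs_summable_le u (b : I -> R) :
  (forall i, normc (u i) <= b i) -> (nsum b < +oo)%E -> abs_summable u.
Proof. by move=> ub boo; apply/abs_summableE; apply: le_lt_trans boo; exact: le_nsum. Qed.

Lemma summable_Re u : abs_summable u ->
  (nsum (fun i => `|complex.Re (u i)|%R) < +oo)%E.
Proof.
by move/abs_summableE; apply: le_lt_trans; apply: le_nsum => i; exact: normRe_le.
Qed.

Lemma summable_Im u : abs_summable u ->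
  (nsum (fun i => `|complex.Im (u i)|%R) < +oo)%E.
Proof.
by move/abs_summableE; apply: le_lt_trans; apply: le_nsum => i; exact: normIm_le.
Qed.

Lemma abs_summableD u v : abs_summable u -> abs_summable v ->
  abs_summable (fun i => u i + v i).
Proof.
move=> /abs_summableE su /abs_summableE sv.
apply: (@abs_summable_le _ (fun i => normc (u i) + normc (v i))).
  by move=> i; exact: (@le_normcD R).
by rewrite nsumD ?lte_add_pinfty // => i; exact: normc_ge0.
Qed.

Lemma abs_summableZ c u : abs_summable u -> abs_summable (fun i => c * u i).
Proof.
move=> /abs_summableE su.
apply: (@abs_summable_le _ (fun i => normc c * normc (u i))).
  by move=> i; rewrite ComplexField.Normc.normcM.
have u0 i : 0 <= normc (u i) by exact: normc_ge0.
by rewrite nsumZ ?normc_ge0 // -(nsum_fin u0 su) -EFinM ltry.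
Qed.

Lemma csumD u v : abs_summable u -> abs_summable v ->
  csum (fun i => u i + v i) = csum u + csum v.
Proof.
move=> su sv; rewrite /csum.
have -> : (fun i => complex.Re (u i + v i)) =
    (fun i => complex.Re (u i) + complex.Re (v i)).
  by apply: funext => i; case: (u i) (v i) => ? ? [].
have -> : (fun i => complex.Im (u i + v i)) =
    (fun i => complex.Im (u i) + complex.Im (v i)).
  by apply: funext => i; case: (u i) (v i) => ? ? [].
by rewrite (rsumD (summable_Re su) (summable_Re sv)) (rsumD (summable_Im su) (summable_Im sv)).
Qed.

Lemma csumZ c u : abs_summable u -> csum (fun i => c * u i) = c * csum u.
Proof.
move=> su; case: c => a b; rewrite /csum.
have sR := summable_Re su; have sI := summable_Im su.
have sZ k (w : I -> R) : (nsum (fun i => `|w i|%R) < +oo)%E ->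
    (nsum (fun i => `|k * w i|%R) < +oo)%E.
  move=> sw; rewrite (_ : (fun _ => _) = (fun i => `|k| * `|w i|)); last first.
    by apply: funext => i; rewrite normrM.
  by rewrite nsumZ // -(nsum_fin _ sw) // -EFinM ltry.
have -> : (fun i => complex.Re ((a +i* b) * u i)) =
    (fun i => a * complex.Re (u i) + (- b) * complex.Im (u i)).
  by apply: funext => i; case: (u i) => ? ? /=; rewrite mulNr.
have -> : (fun i => complex.Im ((a +i* b) * u i)) =
    (fun i => a * complex.Im (u i) + b * complex.Re (u i)).
  by apply: funext => i; case: (u i) => ? ? /=.
rewrite (rsumD (sZ a _ sR) (sZ (- b) _ sI)) (rsumD (sZ a _ sI) (sZ b _ sR)).
by rewrite (rsumZ a sR) (rsumZ (- b) sI) (rsumZ a sI) (rsumZ b sR) mulNr.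
Qed.

Lemma has_sumD u v s t : has_sum u s -> has_sum v t ->
  has_sum (fun i => u i + v i) (s + t).
Proof. by move=> [su ->] [sv ->]; split; [exact: abs_summableD|rewrite csumD]. Qed.

Lemma has_sumZ c u s : has_sum u s -> has_sum (fun i => c * u i) (c * s).
Proof. by move=> [su ->]; split; [exact: abs_summableZ|rewrite csumZ]. Qed.

Lemma has_sum0 : has_sum (fun _ : I => 0 : R[i]) 0.
Proof.
split.
  apply/abs_summableE; rewrite /nsum esum1 ?ltry // => i _.
  by rewrite ComplexField.Normc.normc0.
rewrite /csum /rsum /= !esum1 ?subrr //.
- by move=> i _; rewrite oppr0 maxxx.
- by move=> i _; rewrite maxxx.
Qed.

Lemma eq_has_sum u v s : u =1 v -> has_sum u s -> has_sum v s.
Proof. by move=> /funext->. Qed.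

Lemma has_sum_big (K : Type) (r : seq K) (P : pred K) (u : K -> I -> R[i]) (s : K -> R[i]) :
  (forall k, P k -> has_sum (u k) (s k)) ->
  has_sum (fun i => \sum_(k <- r | P k) u k i) (\sum_(k <- r | P k) s k).
Proof.
move=> us; elim: r => [|k r IH].
  rewrite big_nil; apply: eq_has_sum has_sum0 => i; by rewrite big_nil.
rewrite big_cons; case: ifPn => [Pk|nPk].
  apply: eq_has_sum (has_sumD (us k Pk) IH) => i; by rewrite big_cons Pk.
apply: eq_has_sum IH => i; by rewrite big_cons (negbTE nPk).
Qed.

Lemma has_sum_unique u s t : has_sum u s -> has_sum u t -> s = t.
Proof. by move=> [_ ->] [_ ->]. Qed.

End ComplexSums.

Lemma has_sum_inj (R : realType) (I J : choiceType) (f : J -> I) (u : I -> R[i]) s : injective f ->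
  (forall i, (forall j, f j != i) -> u i = 0) ->
  has_sum u s <-> has_sum (fun j => u (f j)) s.
Proof.
move=> finj uout; rewrite /has_sum !abs_summableE /csum.
rewrite (nsum_inj finj); last 2 first.
- by move=> i; exact: normc_ge0.
- by move=> i /uout ->; rewrite ComplexField.Normc.normc0.
rewrite (rsum_inj finj (u := fun i => complex.Re (u i))); last by move=> i /uout ->.
by rewrite (rsum_inj finj (u := fun i => complex.Im (u i))) // => i /uout ->.
Qed.

Lemma has_sum1 (R : realType) (I : choiceType) (u : I -> R[i]) i0 :
  (forall i, i != i0 -> u i = 0) -> has_sum u (u i0).
Proof.
move=> u0; apply/(@has_sum_inj R I unit (fun=> i0)); first by move=> [] [].
  by move=> i /(_ tt); rewrite eq_sym => /u0.
have T1 : [set: unit]%classic = [set tt]%classic by apply/seteqP; split => -[].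
split; first by apply/abs_summableE; rewrite /nsum T1 esum_set1 ?ltry // lee_fin normc_ge0.
rewrite /csum /rsum !T1 !esum_set1 ?lee_fin ?le_max ?lexx ?orbT //=.
have h (x : R) : Num.max x 0 - Num.max (- x) 0 = x.
  case/orP: (le_total 0 x) => ?.
    by rewrite max_l // max_r ?oppr_le0 // subr0.
  by rewrite max_r // max_l ?oppr_ge0 // sub0r opprK.
by rewrite !h; case: (u i0).
Qed.

(** * Double sums and exchange of summation *)

Section Fubini.
Variables (R : realType) (I J : choiceType).
Implicit Types (u : I * J -> R[i]).

Lemma abs_summable_row u i : abs_summable u -> abs_summable (fun j => u (i, j)).
Proof.
move/abs_summableE => su; apply/abs_summableE.
exact: (nsum_pair_row i (fun x => normc_ge0 (u x)) su).
Qed.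

Lemma abs_summable_pair u (b : I -> R) :
  (forall i, (nsum (fun j => normc (u (i, j))) <= (b i)%:E)%E) ->
  (nsum b < +oo)%E -> abs_summable u.
Proof.
move=> ub boo; apply/abs_summableE.
have fin i : (nsum (fun j => normc (u (i, j))) < +oo)%E.
  by apply: le_lt_trans (ub i) _; rewrite ltry.
have u0 i j : 0 <= normc (u (i, j)) by exact: normc_ge0.
rewrite (@nsum_pair _ _ _ _ (fun i => fine (nsum (fun j => normc (u (i, j)))))).
- apply: le_lt_trans boo; apply: le_nsum => i.
  by rewrite -lee_fin (nsum_fin (u0 i)).
- by move=> x; exact: normc_ge0.
- by move=> i; rewrite (nsum_fin (u0 i)).
Qed.

Lemma normr_rsum_le (K : choiceType) (w : K -> R) : (nsum (fun k => `|w k|%R) < +oo)%E ->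
  `|rsum w| <= fine (nsum (fun k => `|w k|%R)).
Proof.
move=> sw.
have p0 k : 0 <= Num.max (w k) 0 by rewrite le_max lexx orbT.
have m0 k : 0 <= Num.max (- w k) 0 by rewrite le_max lexx orbT.
have pm k : Num.max (w k) 0 <= `|w k| by rewrite ge_max normr_ge0 ler_norm.
have mm k : Num.max (- w k) 0 <= `|w k| by rewrite ge_max normr_ge0 ler_normr lexx orbT.
have fp := le_lt_trans (le_nsum pm) sw.
have fm := le_lt_trans (le_nsum mm) sw.
have w0 k : 0 <= `|w k| by [].
have := le_nsum pm; have := le_nsum mm.
rewrite -(nsum_fin p0 fp) -(nsum_fin m0 fm) -(nsum_fin w0 sw) !lee_fin => h1 h2.
rewrite /rsum -!/(nsum _).
have f1 := fine_ge0 (nsum_ge0 p0); have f2 := fine_ge0 (nsum_ge0 m0).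
by rewrite ler_norml; apply/andP; split; lra.
Qed.

Lemma has_sum_pair u (r : I -> R[i]) s : has_sum u s ->
  (forall i, has_sum (fun j => u (i, j)) (r i)) -> has_sum r s.
Proof.
move=> [su ->] ur.
pose B i := fine (nsum (fun j => normc (u (i, j)))).
have u0 i j : 0 <= normc (u (i, j)) by exact: normc_ge0.
have BE : nsum (fun x => normc (u x)) = nsum B.
  apply: nsum_pair => [x|i]; first exact: normc_ge0.
  have /abs_summableE sui := abs_summable_row i su.
  by rewrite (nsum_fin (u0 i) sui).
split.
  have B0 i : 0 <= B i by rewrite fine_ge0 // nsum_ge0.
  (* One [B i] bounds the real part of the row sum and one bounds the imaginary part. *)
  apply: (@abs_summable_le _ _ _ (fun i => B i + B i)).
    move=> i; apply: le_trans (le_normc_ReIm _) _.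
    have [sui ->] := ur i; have /abs_summableE nui := sui.
    have sR := summable_Re sui; have sI := summable_Im sui.
    rewrite /csum /=; apply: lerD.
      apply: le_trans (normr_rsum_le sR) _.
      rewrite -lee_fin /B (nsum_fin (u0 i)) // nsum_fin //.
      by apply: le_nsum => j; exact: normRe_le.
    apply: le_trans (normr_rsum_le sI) _.
    rewrite -lee_fin /B (nsum_fin (u0 i)) // nsum_fin //.
    by apply: le_nsum => j; exact: normIm_le.
  have /abs_summableE nu := su.
  by rewrite (nsumD B0 B0) -BE (lte_add_pinfty nu nu).
have -> : r = (fun i => csum (fun j => u (i, j))).
  by apply: funext => i; have [_ ->] := ur i.
by rewrite /csum (rsum_pair (summable_Re su)) (rsum_pair (summable_Im su)).
Qed.

End Fubini.

Lemma has_sum_swap (R : realType) (I J : choiceType) (u : I * J -> R[i])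
    (r : J -> R[i]) s : has_sum u s ->
  (forall j, has_sum (fun i => u (i, j)) (r j)) -> has_sum r s.
Proof.
move=> us ur; apply: (@has_sum_pair _ _ _ (fun x : J * I => u (x.2, x.1))) ur.
have finj : injective (fun x : J * I => (x.2, x.1)) by move=> [? ?] [? ?] [-> ->].
by apply/(has_sum_inj (u := u) _ finj) => // -[i j] /(_ (j, i)); rewrite eqxx.
Qed.

(** * Criteria for summability of power series *)

Section PowerBounds.
Variable R : realType.

Lemma nsum_nat_le (a : nat -> R) M : (forall k, 0 <= a k) ->
  (forall N, \sum_(k < N) a k <= M) -> (nsum a <= M%:E)%E.
Proof.
move=> a0 aM; apply: nsum_le_bound => // F.
pose N := (\max_(k <- F) k).+1.
apply: le_trans (aM N); rewrite -(big_mkord predT a).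
have -> : \sum_(k <- F) a k = \sum_(0 <= k < N | k \in F) a k.
  rewrite -[RHS]big_filter; apply: perm_big; apply: uniq_perm.
  - exact: fset_uniq.
  - by rewrite filter_uniq // iota_uniq.
  - move=> k; rewrite mem_filter mem_index_iota /=; case: (boolP (k \in F)) => //= kF.
    by rewrite /N ltnS (leq_bigmax_seq (F := id)).
by rewrite big_mkcond ler_sum // => k _; case: ifP.
Qed.

Lemma nsum_geo (C : R) : 0 <= C -> (nsum (fun k : nat => (C * 2^-1 ^+ k)%R) < +oo)%E.
Proof.
move=> C0; apply: (@le_lt_trans _ _ (C * 2)%:E); last by rewrite ltry.
apply: nsum_nat_le => [k|N]; first by rewrite mulr_ge0 // exprn_ge0 // invr_ge0.
rewrite -mulr_sumr ler_wpM2l //.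
have -> : \sum_(k < N) 2^-1 ^+ k = 2 - 2 * 2^-1 ^+ N :> R.
  elim: N => [|N IH]; first by rewrite big_ord0 expr0 mulr1 subrr.
  by rewrite big_ord_recr /= IH exprS; field.
by rewrite lerBlDr lerDl mulr_ge0 // exprn_ge0 // invr_ge0.
Qed.

(** The ratio bound $P^k B$ tends to 0, so it is at most $1/2$ from some [N] on and [a] is dominated
    by a geometric sequence. The constant [C] sums the terms up to [N] weighted by $2^k$, which
    covers the initial range. *)
Lemma ratio_summable (P B : R) (a : nat -> R) : 0 <= P < 1 -> 0 <= B ->
  (forall k, 0 <= a k) -> (forall k, a k.+1 <= P ^+ k * B * a k) ->
  (nsum a < +oo)%E.
Proof.
move=> /andP[P0 P1] B0 a0 aS.
have [N NB] : exists N, forall k, (N <= k)%N -> P ^+ k * B <= 2^-1.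
  have := @cvg_expr R P; rewrite ger0_norm // => /(_ P1) cP.
  have eps0 : 0 < 2^-1 / (B + 1) :> R.
    by rewrite divr_gt0 ?invr_gt0 // ltr_wpDl.
  move/cvgrPdist_lt: cP => /(_ _ eps0) [N _ NP]; exists N => k Nk.
  have := NP k Nk; rewrite /= sub0r normrN ger0_norm ?exprn_ge0 // => /ltW h.
  have B1 : 0 < B + 1 by rewrite ltr_wpDl.
  move: h; rewrite ler_pdivlMr // => h; apply: le_trans h.
  by rewrite ler_wpM2l ?exprn_ge0 // lerDl.
have [C C0 aC] : exists2 C, 0 <= C & forall k, a k <= C * 2^-1 ^+ k.
  pose C := \sum_(k < N.+1) a k * 2 ^+ k.
  have t0 k : 0 <= a k * 2 ^+ k by rewrite mulr_ge0 // exprn_ge0.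
  have lt0 : forall k, (k <= N)%N -> a k <= C * 2^-1 ^+ k.
    move=> k kN; rewrite exprVn ler_pdivlMr ?exprn_gt0 //.
    by rewrite /C (bigD1 (Ordinal (kN : (k < N.+1)%N))) //= lerDl sumr_ge0.
  exists C; first by rewrite sumr_ge0.
  elim=> [|k IH]; first exact: lt0.
  case: (leqP k.+1 N) => [|Nk]; first exact: lt0.
  apply: le_trans (aS k) _; rewrite exprS mulrCA.
  by apply: ler_pM => //; rewrite ?mulr_ge0 ?exprn_ge0 ?NB.
by apply: le_lt_trans (le_nsum aC) (nsum_geo C0).
Qed.

End PowerBounds.

(** A finite set of exponents lies in a cube $[0,N)^n$, and over a cube the sum of products is a
    product of one-variable sums. *)
Lemma nsum_expo_prod (R : realType) (n : nat) (a : 'I_n -> nat -> R) :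
  (forall j k, 0 <= a j k) -> (forall j, (nsum (a j) < +oo)%E) ->
  (nsum (fun e : expo n => (\prod_j a j (e j))%R) < +oo)%E.
Proof.
move=> a0 aoo.
have p0 e : 0 <= \prod_j a j ((e : expo n) j) by apply: prodr_ge0.
apply: (@le_lt_trans _ _ (\prod_j fine (nsum (a j)))%:E); last by rewrite ltry.
apply: nsum_le_bound => // F.
pose N := (\max_(e <- F) expo_deg e).+1.
pose G := [seq expo_of d | d : {ffun 'I_n -> 'I_N}].
have FG e : e \in F -> e \in G.
  move=> eF; apply/mapP; exists [ffun j => inord (e j)]; first by rewrite mem_enum.
  apply/ffunP => j; rewrite !ffunE inordK // ltnS.
  by apply: leq_trans (leq_expo_deg e j) _; exact: leq_bigmax_seq.
apply: (@le_trans _ _ (\sum_(e <- G) \prod_j a j (e j))).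
  have -> : \sum_(e <- F) \prod_j a j (e j) =
      \sum_(e <- G | e \in F) \prod_j a j (e j).
    rewrite -[RHS]big_filter; apply: perm_big; apply: uniq_perm.
    - exact: fset_uniq.
    - rewrite filter_uniq // map_inj_uniq ?enum_uniq //; exact: expo_of_inj.
    - by move=> e; rewrite mem_filter; case: (boolP (e \in F)) => // /FG ->.
  by rewrite big_mkcond ler_sum // => e _; case: ifP.
rewrite /G big_image /=.
under eq_bigr => d _ do under eq_bigr => j _ do rewrite ffunE.
rewrite -(bigA_distr_bigA (fun j (k : 'I_N) => a j k)).
apply: ler_prod => j _; rewrite sumr_ge0 //=.
have := @fset_le_nsum R _ (a j) [fset k in iota 0 N]%fset (a0 j) (aoo j).
rewrite -(big_mkord predT (a j)) /index_iota subn0.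
rewrite (perm_big (iota 0 N)) //; apply: uniq_perm; rewrite ?fset_uniq ?iota_uniq //.
by move=> k; rewrite in_fset.
Qed.

(** * Normal ordering *)

Section TwistedProducts.
Variables (R : realType) (n : nat) (p : R[i]) (b : rel 'I_n).
Hypothesis b_irr : irreflexive b.
Local Notation S := (twseries p b).
Implicit Types (d e : expo n) (c : nat -> R[i]) (i j : 'I_n).

Definition fexp i k : expo n := [ffun j => if j == i then k else 0%N].

Definition fupd e i k : expo n := [ffun j => if j == i then k else e j].

Definition fsub e d : expo n := [ffun j => (e j - d j)%N].

(** The series $\sum_k c_k X_i^k$; the test says that [e] is supported at [i]. *)
Definition single i c : S := fun e => if e == fexp i (e i) then c (e i) else 0.

(** Coefficients of $z^k c(z)$. *)
Definition shift k c : nat -> R[i] := fun m => if (k <= m)%N then c (m - k)%N else 0.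

Lemma fexpE i k j : fexp i k j = if j == i then k else 0%N.
Proof. by rewrite ffunE. Qed.

Lemma fupd_split e i : fexp i (e i) + fupd e i 0 = e.
Proof. by apply/ffunP => j; rewrite !ffunE; case: eqP => [->|_]; rewrite ?addr0 ?add0r. Qed.

Lemma gen_expE i k : gen i ^+ k = mono (fexp i k) :> S.
Proof. exact: genX. Qed.

Lemma fsubK d e : [forall i, d i <= e i]%N -> d + fsub e d = e.
Proof. by move=> /forallP de; apply/ffunP => i; rewrite !ffunE; apply: subnKC. Qed.

Lemma mono_mulE d (f : S) e : (mono d * f : S) e =
  if [forall i, d i <= e i]%N then p ^+ twist b d (fsub e d) * f (fsub e d) else 0.
Proof.
rewrite /GRing.mul /= /tw_mul; case: ifPn => [de|nde].
  rewrite (@big_splits1 _ _ _ _ (d, fsub e d)) /=; last 2 first.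
  - exact: fsubK.
  - move=> [y1 y2]; rewrite mem_splits xpair_eqE negb_and /= => /eqP <- /orP[/negbTE h|h].
      by rewrite /mono h mul0r mulr0.
    rewrite /mono; case: (y1 =P d) h => [-> h|]; last by rewrite mul0r mulr0.
    case/negP: h; apply/eqP/ffunP => i; rewrite !ffunE.
    by rewrite addKn.
  by rewrite /mono eqxx mul1r.
rewrite big_seq big1 // => -[y1 y2]; rewrite mem_splits /= => /eqP ye.
rewrite /mono; case: eqP => [y1d|]; last by rewrite mul0r mulr0.
case/negP: nde; apply/forallP => i.
by rewrite -ye -y1d ffunE leq_addr.
Qed.

Lemma mul_monoE d (f : S) e : (f * mono d : S) e =
  if [forall i, d i <= e i]%N then p ^+ twist b (fsub e d) d * f (fsub e d) else 0.
Proof.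
rewrite /GRing.mul /= /tw_mul; case: ifPn => [de|nde].
  rewrite (@big_splits1 _ _ _ _ (fsub e d, d)) /=; last 2 first.
  - by rewrite addrC; exact: fsubK.
  - move=> [y1 y2]; rewrite mem_splits xpair_eqE negb_and /= orbC => /eqP <- /orP[/negbTE h|h].
      by rewrite /mono h !mulr0.
    rewrite /mono; case: (y2 =P d) h => [-> h|]; last by rewrite !mulr0.
    case/negP: h; apply/eqP/ffunP => i; rewrite !ffunE.
    by rewrite addnK.
  by rewrite /mono eqxx mulr1.
rewrite big_seq big1 // => -[y1 y2]; rewrite mem_splits /= => /eqP ye.
rewrite /mono; case: eqP => [y2d|]; last by rewrite !mulr0.
case/negP: nde; apply/forallP => i.
by rewrite -ye -y2d ffunE leq_addl.
Qed.

Lemma twist_fexp_same i k l : twist b (fexp i k) (fexp i l) = 0%N.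
Proof.
apply: big1 => j _; apply: big1 => j' bjj; rewrite !ffunE.
case: eqP => // ji; case: eqP => [j'i|]; last by rewrite muln0.
by rewrite ji j'i b_irr in bjj.
Qed.

Lemma fexp_le i k e : [forall j, fexp i k j <= e j]%N = (k <= e i)%N.
Proof.
apply/forallP/idP => [/(_ i)|h j]; first by rewrite fexpE eqxx.
by rewrite fexpE; case: eqP => [->|].
Qed.

Lemma fsub_fexp i k e : (k <= e i)%N ->
  (fsub e (fexp i k) == fexp i (e i - k)) = (e == fexp i (e i)).
Proof.
move=> ke; apply/eqP/eqP => /ffunP h; apply/ffunP => j; have := h j; rewrite !ffunE.
- by case: eqP => [->//|_]; rewrite subn0.
- by case: eqP => [->//|_ ->]; rewrite subn0.
Qed.

Lemma single_mul_mono i c k : single i c * mono (fexp i k) = single i (shift k c).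
Proof.
apply: funext => e; rewrite mul_monoE fexp_le /single /shift.
case: ifPn => [ke|]; last by rewrite if_same.
rewrite [fsub e _ i]ffunE fexpE eqxx fsub_fexp //.
case: eqP => [ee|_]; last by rewrite mulr0.
rewrite ee (_ : fsub _ _ = fexp i (e i - k)); last first.
  by apply/ffunP => j; rewrite !ffunE; case: eqP; rewrite // subn0.
by rewrite twist_fexp_same expr0 mul1r fexpE eqxx.
Qed.

Lemma mono_mul_single i c k : mono (fexp i k) * single i c = single i (shift k c).
Proof.
apply: funext => e; rewrite mono_mulE fexp_le /single /shift.
case: ifPn => [ke|]; last by rewrite if_same.
rewrite [fsub e _ i]ffunE fexpE eqxx fsub_fexp //.
case: eqP => [ee|_]; last by rewrite mulr0.
rewrite ee (_ : fsub _ _ = fexp i (e i - k)); last first.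
  by apply/ffunP => j; rewrite !ffunE; case: eqP; rewrite // subn0.
by rewrite twist_fexp_same expr0 mul1r fexpE eqxx.
Qed.

Lemma series_at_sqr (g : nat -> R[i]) (t : R[i]) i :
  series_at g (t *: (gen i ^+ 2 : S)) =
  single i (fun m => if odd m then 0 else g m./2 * t ^+ m./2).
Proof.
apply: funext => e; rewrite /series_at.
have E k : ((t *: (gen i ^+ 2 : S)) ^+ k) e = t ^+ k * (e == fexp i (2 * k))%:R.
  rewrite exprZn -exprM gen_expE //.
under eq_bigr do rewrite E.
rewrite /single; case: eqP => [ee|ne]; last first.
  apply: big1 => k _; case: eqP => [ek|]; last by rewrite !mulr0.
  by case: ne; rewrite ek fexpE eqxx.
case: ifP => [oe|ev].
  apply: big1 => k _; case: eqP => [ek|]; last by rewrite !mulr0.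
  by rewrite ek fexpE eqxx oddM in oe.
have e2 : e i = (2 * (e i)./2)%N by rewrite mul2n -[LHS]odd_double_half ev.
(* The only contributing power is [(e i)./2], and it lies below the truncation bound in
   [series_at]. *)
have lt : ((e i)./2 < (expo_deg e).+1)%N.
  have := leq_expo_deg e i; lia.
rewrite (bigD1 (Ordinal lt)) //= [X in _ + X]big1 ?addr0.
  by rewrite -e2 -ee eqxx mulr1.
move=> k /negP nk; case: eqP => [ek|]; last by rewrite !mulr0.
have ei : e i = (2 * k)%N by rewrite {1}ek fexpE eqxx.
by case: nk; apply/eqP/val_inj => /=; rewrite ei mul2n doubleK.
Qed.

Lemma single_sum (K : finType) (P : pred K) (h : K -> R[i]) (c : K -> nat -> R[i]) i :
  \sum_(k | P k) h k *: single i (c k) =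
  single i (fun m => \sum_(k | P k) h k * c k m).
Proof.
apply: funext => e.
have -> : (\sum_(k | P k) h k *: single i (c k)) e =
    \sum_(k | P k) h k * single i (c k) e.
  by elim/big_ind2: _ => // f x g y <- <-.
rewrite /single; case: eqP => // _; apply: big1 => k _; exact: mulr0.
Qed.

(** As [g] does not involve $X_i$, the exponent [e] splits in one way only: its entry at [i] comes
    from the first factor and all else from [g]. *)
Lemma single_mulE i c (g : S) e :
  (forall e', e' i != 0%N -> g e' = 0) ->
  (single i c * g) e =
  p ^+ twist b (fexp i (e i)) (fupd e i 0) * (c (e i) * g (fupd e i 0)).
Proof.
move=> g0; rewrite /GRing.mul /= /tw_mul.
rewrite (@big_splits1 _ _ _ _ (fexp i (e i), fupd e i 0)) /=; last 2 first.
- exact: fupd_split.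
- move=> [y1 y2]; rewrite mem_splits xpair_eqE /= => /eqP ye ny.
  have [y20|/g0->] := eqVneq (y2 i) 0%N; last by rewrite !mulr0.
  rewrite /single; case: eqP => [y1e|]; last by rewrite mul0r mulr0.
  have ei : e i = y1 i by rewrite -ye ffunE y20 addr0.
  case/negP: ny; rewrite ei -y1e eqxx /=; apply/eqP/ffunP => j.
  rewrite ffunE -ye ffunE; case: eqP => [->//|ji].
  by rewrite y1e fexpE; case: eqP => // _; rewrite add0r.
by rewrite /single fexpE eqxx eqxx.
Qed.

Lemma mono0E e : (1 : S) e = (e == 0)%:R. Proof. by []. Qed.

Local Notation supp s e := [forall j, (j \notin s) ==> (e j == 0%N)].

Lemma supp_nil e : supp [::] e = (e == 0).
Proof.
apply/forallP/eqP => [h|-> j]; last by rewrite ffunE.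
by apply/ffunP => j; rewrite ffunE; apply/eqP; exact: h.
Qed.

Lemma supp_cons i s e : supp s (fupd e i 0) = supp (i :: s) e.
Proof.
apply: eq_forallb => j; rewrite in_cons negb_or ffunE.
by case: (j == i); rewrite ?implybT.
Qed.

Lemma prod_fupd i s (c : 'I_n -> nat -> R[i]) e : i \notin s ->
  \prod_(j <- s) c j (fupd e i 0 j) = \prod_(j <- s) c j (e j).
Proof.
move=> nis; apply: eq_big_seq => j js; rewrite ffunE; case: eqP => // ji.
by rewrite -ji js in nis.
Qed.

(** The factors stand in the order opposite to the normal one, so normal ordering swaps every pair
    of variables and produces the full twist of [e] with itself. *)
Lemma prod_single_twist (s : seq 'I_n) (c : 'I_n -> nat -> R[i]) e :
  uniq s -> pairwise (fun i j => b i j && ~~ b j i) s ->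
  (\prod_(j <- s) single j (c j) : S) e =
  if supp s e then p ^+ twist b e e * \prod_(j <- s) c j (e j) else 0.
Proof.
elim: s e => [|i s IH] e.
  rewrite !big_nil mono0E supp_nil => _ _; case: eqP => // ->.
  by rewrite twist0l mulr1.
move=> /= /andP[nis us] /andP[/allP bi ps]; rewrite !big_cons single_mulE; last first.
  move=> e' e'i; rewrite IH //; case: ifP => // /forallP/(_ i).
  by rewrite nis (negbTE e'i).
rewrite IH // supp_cons prod_fupd //; case: ifPn => [|_]; last by rewrite !mulr0.
move=> /forallP he; rewrite mulrCA -[in RHS](fupd_split e i).
set x := fexp i (e i); set y := fupd e i 0.
rewrite twistDl !twistDr twist_fexp_same add0n.
(* The exponent [y] lives on the indices of [s], and these are never related by [b] to the head
   [i]. *)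
rewrite (_ : twist b y x = 0%N) ?add0n ?exprD; first by rewrite fupd_split; ring.
apply: big1 => j _; apply: big1 => k bjk; rewrite /x fexpE.
case: eqP => [ki|]; last by rewrite muln0.
rewrite /y ffunE; case: eqP => // /eqP ji; have := he j; rewrite in_cons negb_or ji /=.
case: (boolP (j \in s)) => [/bi /andP[_]|_ /eqP->//].
by rewrite -ki bjk.
Qed.

(** Here the factors already stand in normal order, so no power of [p] appears. *)
Lemma prod_single_ordered (s : seq 'I_n) (c : 'I_n -> nat -> R[i]) e :
  uniq s -> pairwise (fun i j => ~~ b i j) s ->
  (\prod_(j <- s) single j (c j) : S) e =
  if supp s e then \prod_(j <- s) c j (e j) else 0.
Proof.
elim: s e => [|i s IH] e.
  by rewrite !big_nil mono0E supp_nil => _ _; case: eqP.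
move=> /= /andP[nis us] /andP[/allP bi ps]; rewrite !big_cons single_mulE; last first.
  move=> e' e'i; rewrite IH //; case: ifP => // /forallP/(_ i).
  by rewrite nis (negbTE e'i).
rewrite IH // supp_cons prod_fupd //; case: ifPn => [|_]; last by rewrite !mulr0.
move=> /forallP he.
rewrite (_ : twist _ _ _ = 0%N) ?expr0 ?mul1r //.
apply: big1 => j _; apply: big1 => k bjk; rewrite fexpE.
case: eqP => [ji|]; last by rewrite mul0n.
rewrite ffunE; case: eqP => [|/eqP ki]; rewrite ?muln0 //.
have := he k; rewrite in_cons negb_or ki /=.
case: (boolP (k \in s)) => [/bi|_ /eqP->//]; last by rewrite muln0.
by rewrite -ji bjk.
Qed.

End TwistedProducts.

Arguments single {R n p b}.

Lemma pairwise_rev_ord n :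
  pairwise (fun i j : 'I_n => (j < i)%N) [seq rev_ord j | j <- index_enum 'I_n].
Proof.
rewrite pairwise_map /index_enum -enumT.
have : pairwise ltn (map val (enum 'I_n)).
  by rewrite val_enum_ord -sorted_pairwise ?iota_ltn_sorted //; exact: ltn_trans.
rewrite pairwise_map; apply: sub_pairwise => i j /= ij.
by rewrite ltn_sub2l // (leq_ltn_trans ij).
Qed.

Lemma perm_rev_ord n : perm_eq [seq rev_ord j | j <- index_enum 'I_n] (index_enum 'I_n).
Proof.
apply: uniq_perm; rewrite ?index_enum_uniq ?map_inj_uniq ?index_enum_uniq //.
  exact: rev_ord_inj.
move=> j; rewrite mem_index_enum; apply/mapP; exists (rev_ord j).
  by rewrite mem_index_enum.
by rewrite rev_ordK.
Qed.

Section DecreasingProducts.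
Variables (R : realType) (n : nat) (q : R).
Implicit Types (c : 'I_n -> nat -> R[i]) (e : expo n).

Let supp_all e :
  [forall j, (j \notin [seq rev_ord j | j <- index_enum 'I_n]) ==> (e j == 0%N)].
Proof. by apply/forallP => j; rewrite (perm_mem (perm_rev_ord n)) mem_index_enum. Qed.

(** Decreasing order is opposite to the normal order of $\mathcal A$; this is the source of the
    cross terms $q^{e_ie_j}$. In $\mathcal D$ decreasing order is the normal one. *)
Lemma prod_single_qA c e :
  (\prod_(j < n) single (rev_ord j) (c (rev_ord j)) : qA q n) e =
  q%:C ^+ (\sum_(i < n) \sum_(j < n | (j < i)%N) e i * e j)%N * \prod_j c j (e j).
Proof.
rewrite -(big_map (@rev_ord n) predT (fun j => single j (c j))).
rewrite prod_single_twist ?supp_all.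
- by congr (_ * _); apply: perm_big; exact: perm_rev_ord.
- by move=> i; rewrite ltnn.
- by rewrite (perm_uniq (perm_rev_ord n)) index_enum_uniq.
- apply: sub_pairwise (pairwise_rev_ord n) => i j /= ij.
  by rewrite ij -leqNgt ltnW.
Qed.

Lemma prod_single_qD c e :
  (\prod_(j < n) single (rev_ord j) (c (rev_ord j)) : qD q n) e = \prod_j c j (e j).
Proof.
rewrite -(big_map (@rev_ord n) predT (fun j => single j (c j))).
rewrite prod_single_ordered ?supp_all.
- by apply: perm_big; exact: perm_rev_ord.
- by rewrite (perm_uniq (perm_rev_ord n)) index_enum_uniq.
- apply: sub_pairwise (pairwise_rev_ord n) => i j /= ij.
  by rewrite -leqNgt ltnW.
Qed.

End DecreasingProducts.

(** * Sums over initial segments of the index set *)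

Section OrdPrefix.
Variables (n : nat).

Lemma big_ord_ltS (T : Type) (idx : T) (op : Monoid.com_law idx) (F : 'I_n -> T) N
    (Nn : (N < n)%N) :
  \big[op/idx]_(j < n | (j < N.+1)%N) F j =
  op (F (Ordinal Nn)) (\big[op/idx]_(j < n | (j < N)%N) F j).
Proof.
rewrite (bigD1 (Ordinal Nn)) //=; congr (op _ _); apply: eq_bigl => j.
rewrite ltnS leq_eqVlt -val_eqE /=.
by case: (ltngtP j N).
Qed.

(** Splits the quadratic exponent $\binom k2$ of [E_coef] into one-variable exponents and cross
    terms, the latter matching the twist. *)
Lemma binom2_sum (m : 'I_n -> nat) :
  'C(\sum_j m j, 2) =
  (\sum_j 'C(m j, 2) + \sum_(i < n) \sum_(j < n | (j < i)%N) m i * m j)%N.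
Proof.
have binD a c : 'C(a + c, 2) = ('C(a, 2) + 'C(c, 2) + a * c)%N.
  elim: c => [|c IH]; first by rewrite addn0 muln0 !addn0.
  rewrite addnS !binS IH !bin1; lia.
suff H N : (N <= n)%N -> 'C(\sum_(j < n | (j < N)%N) m j, 2) =
    (\sum_(i < n | (i < N)%N) ('C(m i, 2) + \sum_(j < n | (j < i)%N) m i * m j))%N.
  rewrite -big_split /=; have := H n (leqnn n).
  have T (F : 'I_n -> nat) : (\sum_(j < n | (j < n)%N) F j = \sum_j F j)%N.
    by apply: eq_bigl => j; rewrite ltn_ord.
  by rewrite !T.
elim: N => [|N IH] Nn; first by rewrite !big_pred0.
rewrite !(big_ord_ltS _ _ Nn) /= binD IH ?(ltnW Nn) // -big_distrr /=; lia.
Qed.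

Lemma telescope_exp (F : comPzRingType) (P : F) (m : 'I_n -> nat) :
  \sum_(j < n) P ^+ (\sum_(i < n | (i < j)%N) m i) * (1 - P ^+ m j) =
  1 - P ^+ (\sum_j m j).
Proof.
(* The sum telescopes along initial segments of the indices, so the induction is on their length
   [N]. *)
suff H N : (N <= n)%N ->
    \sum_(j < n | (j < N)%N) P ^+ (\sum_(i < n | (i < j)%N) m i) * (1 - P ^+ m j) =
    1 - P ^+ (\sum_(i < n | (i < N)%N) m i).
  rewrite (eq_bigl (fun j : 'I_n => (j < n)%N)); last by move=> j; rewrite ltn_ord.
  rewrite H //; congr (1 - _ ^+ _).
  by apply: eq_bigl => j; rewrite ltn_ord.
elim: N => [|N IH] Nn; first by rewrite !big_pred0 // expr0 subrr.
by rewrite !(big_ord_ltS _ _ Nn) /= IH ?(ltnW Nn) // exprD; ring.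
Qed.

End OrdPrefix.

(** * Normally ordered coefficients of the Gaussian and Hermite factors *)

Section QCoefficients.
Variables (R : realType) (q : R).
Hypothesis q01 : 0 < q < 1.
Local Notation p := (q%:C).

Lemma qpoch0 (F : fieldType) (a c : F) : qpoch a c 0 = 1.
Proof. by rewrite /qpoch big_ord0. Qed.

Lemma qpochS (F : fieldType) (a c : F) k : qpoch a c k.+1 = qpoch a c k * (1 - a * c ^+ k).
Proof. by rewrite /qpoch big_ord_recr. Qed.

Lemma one_sub_pX_neq0 k : (0 < k)%N -> 1 - p ^+ k != 0.
Proof.
move=> k0; rewrite -rmorphXn -[1]/((1 : R)%:C) -rmorphB /=.
rewrite -[0]/((0 : R)%:C) (inj_eq (@complexI R)) subr_eq0 eq_sym lt_eqF //.
by case/andP: q01 => /ltW q0 q1; rewrite exprn_ilt1 // -lt0n.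
Qed.

Lemma p_neq0 : p != 0.
Proof.
by rewrite -[0]/((0 : R)%:C) (inj_eq (@complexI R)); case/andP: q01 => /lt0r_neq0.
Qed.

Lemma qpoch_neq0 k m : (0 < k)%N -> qpoch (p ^+ k) (p ^+ k) m != 0.
Proof.
move=> k0; apply/prodf_neq0 => l _.
by rewrite -exprM -exprD one_sub_pX_neq0 // addn_gt0 k0.
Qed.

(* The coefficients of [E_(q^4)(- q^4 z^2)], of [h_l(z; q^2)] (at [z^(l - 2k)]), of
   their product, and of [e_(q^4)(- z^2)]. *)
Definition wcoef (m : nat) : R[i] :=
  if odd m then 0 else E_coef (p ^+ 4) m./2 * (- p ^+ 4) ^+ m./2.

Definition hcoef (l k : nat) : R[i] :=
  qpoch (p ^+ 2) (p ^+ 2) l * ((-1) ^+ k * p ^+ (2 * (k * k.-1)) /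
     (qpoch (p ^+ 4) (p ^+ 4) k * qpoch (p ^+ 2) (p ^+ 2) (l - 2 * k))).

Definition ucoef (l m : nat) : R[i] :=
  \sum_(k < l./2.+1) hcoef l k * shift (l - 2 * k) wcoef m.

Definition dcoef (m : nat) : R[i] :=
  if odd m then 0 else e_coef (p ^+ 4) m./2 * (-1) ^+ m./2.

Variable n : nat.
Local Notation xA := (@gen R n p (fun i j : 'I_n => (j < i)%N)).
Local Notation xD := (@gen R n p (fun i j : 'I_n => (i < j)%N)).

Let A_irr : irreflexive (fun i j : 'I_n => (j < i)%N).
Proof. by move=> i; rewrite ltnn. Qed.

Let D_irr : irreflexive (fun i j : 'I_n => (i < j)%N).
Proof. by move=> i; rewrite ltnn. Qed.

Lemma gauss_hermite_single (i : 'I_n) l :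
  (series_at (E_coef (p ^+ 4)) (- (p ^+ 4 *: xA i ^+ 2))
     * dHermite p l (xA i)) = single i (ucoef l).
Proof.
rewrite -scaleNr series_at_sqr // /dHermite -scalerAr mulr_sumr scaler_sumr.
rewrite -[RHS]single_sum; apply: eq_bigr => k _.
by rewrite -scalerAr scalerA gen_expE // single_mul_mono.
Qed.

Lemma derivative_single (i : 'I_n) a :
  (xD i ^+ a * series_at (e_coef (p ^+ 4)) (- xD i ^+ 2))
  = single i (shift a dcoef).
Proof. by rewrite -scaleN1r series_at_sqr // gen_expE // mono_mul_single. Qed.

(** Normal ordering moves $x_i^2$ to the right past each $x_j$ with $j<i$, which costs
    $q^{2e_j}$. *)
Lemma mono_mul_sqr (i : 'I_n) (f : qA q n) (e : expo n) :
  (xA i ^+ 2 * f) e =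
  if (1 < e i)%N then (p ^+ (2 * \sum_(j < n | (j < i)%N) e j)
                       * f (fsub e (fexp i 2))) else 0.
Proof.
rewrite gen_expE // mono_mulE fexp_le; case: ifP => // e2; congr (_ ^+ _ * _).
rewrite /twist (bigD1 i) //= [X in (_ + X)%N]big1 ?addn0; last first.
  by move=> j /negbTE ji; apply: big1 => k _; rewrite fexpE ji.
rewrite big_distrr /=; apply: eq_bigr => j ji; rewrite !ffunE eqxx.
by case: eqP => [jj|_]; [rewrite jj ltnn in ji|rewrite subn0].
Qed.

(* The q-multinomial theorem: the squares [x_j ^+ 2] satisfy the relations of the
   [x_j] with parameter [q ^+ 4]. *)
Lemma sum_sqr_exp k (e : expo n) :
  ((\sum_(j < n) xA j ^+ 2) ^+ k) e =
  if [forall j, ~~ odd (e j)] && (expo_deg e == 2 * k)%N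
  then qpoch (p ^+ 4) (p ^+ 4) k / \prod_j qpoch (p ^+ 4) (p ^+ 4) (e j)./2
  else 0.
Proof.
elim: k e => [|k IH] e.
  rewrite expr0 mono0E muln0; case: eqP => [->|/eqP ne].
    rewrite qpoch0 big1 ?invr1 ?mulr1; last by move=> j _; rewrite ffunE qpoch0.
    rewrite ifT // /expo_deg big1; last by move=> j _; rewrite ffunE.
    by rewrite andbT; apply/forallP => j; rewrite ffunE.
  rewrite ifF //; apply/negbTE; rewrite negb_and; apply/orP; right.
  apply: contra ne; rewrite sum_nat_eq0 => /forallP h.
  by apply/eqP/ffunP => j; rewrite ffunE; apply/eqP; exact: h.
rewrite exprS mulr_suml.
have -> (F : 'I_n -> qA q n) : (\sum_j F j) e = \sum_j F j e.
  by elim/big_ind2: _ => // f x g y <- <-.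
rewrite (eq_bigr _ (fun j _ => mono_mul_sqr j _ e)).
under eq_bigr => j _ do rewrite IH.
have ev_sub j : (1 < e j)%N ->
    [forall i, ~~ odd (fsub e (fexp j 2) i)] = [forall i, ~~ odd (e i)].
  move=> e2; apply: eq_forallb => i; rewrite !ffunE; case: eqP => [->|_].
    by rewrite oddB // addbF.
  by rewrite subn0.
have deg_sub j : (1 < e j)%N -> expo_deg e = (2 + expo_deg (fsub e (fexp j 2)))%N.
  move=> e2; rewrite /expo_deg (bigD1 j) //= [in RHS](bigD1 j) //= !ffunE eqxx.
  rewrite addnA subnKC //; congr addn; apply: eq_bigr => i /negbTE ij.
  by rewrite !ffunE ij subn0.
case: ifPn => [/andP[ev /eqP dg]|nev]; last first.
  apply: big1 => j _; case: ifP => // e2; rewrite ev_sub // ifF ?mulr0 //.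
  apply: contraNF nev => /andP[-> /eqP h] /=; rewrite (deg_sub _ e2) h.
  by rewrite mulnS.
have e2m j : e j = (2 * (e j)./2)%N.
  by rewrite mul2n -[LHS]odd_double_half; have /forallP/(_ j)/negbTE-> := ev.
have km : (\sum_j (e j)./2 = k.+1)%N.
  apply/eqP; rewrite -(eqn_pmul2l (m := 2)) // -dg big_distrr /=.
  by rewrite /expo_deg; apply/eqP; apply: eq_bigr => j _; rewrite -e2m.
pose P : R[i] := p ^+ 4; pose D : R[i] := \prod_j qpoch P P (e j)./2.
have D0 : D != 0 by apply/prodf_neq0 => j _; exact: qpoch_neq0.
(* The new factor $1-P^{k+1}$ of [qpoch P P k.+1] is written as a telescoping sum over $j$, so that
   both sides agree term by term. *)
transitivity (\sum_(j < n) qpoch P P k / D *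
    (P ^+ (\sum_(i < n | (i < j)%N) (e i)./2) * (1 - P ^+ (e j)./2))); last first.
  rewrite -mulr_sumr telescope_exp km qpochS /P -exprS; rewrite -/P -/D; ring.
(* If [e j < 2] then [e j = 0], the entry being even, and the telescoping term vanishes as well. *)
apply: eq_bigr => j _; case: ifP => [e2|/negbT e2]; last first.
  have -> : ((e j)./2 = 0)%N by have := e2m j; lia.
  by rewrite expr0 subrr !mulr0.
rewrite ev_sub // ev /= ifT; last first.
  by move: dg; rewrite (deg_sub _ e2) mulnS => /eqP; rewrite eqn_add2l.
have -> : p ^+ (2 * \sum_(i < n | (i < j)%N) e i) =
    P ^+ (\sum_(i < n | (i < j)%N) (e i)./2).
  rewrite -exprM; congr (_ ^+ _); rewrite -[4%N]/(2 * 2)%N -mulnA; congr muln.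
  by rewrite big_distrr; apply: eq_bigr => i _.
have DE : D = (1 - P ^+ (e j)./2) *
    \prod_i qpoch P P (fsub e (fexp j 2) i)./2.
  rewrite /D (bigD1 j) //= [in RHS](bigD1 j) //= mulrA; congr (_ * _); last first.
    by apply: eq_bigr => i /negbTE ij; rewrite !ffunE ij subn0.
  rewrite !ffunE eqxx; have : (0 < (e j)./2)%N by have := e2m j; lia.
  have -> : ((e j - 2)./2 = (e j)./2.-1)%N by have := e2m j; lia.
  case: ((e j)./2) => // m _ /=.
  by rewrite qpochS -exprS mulrC.
rewrite DE; have := D0; rewrite DE mulf_eq0 negb_or => /andP[h1 h2].
by rewrite -/P; field; rewrite h2 h1.
Qed.

(** Coefficient form of the factorisation of $E_{q^4}(-q^4\sum_jx_j^2)$. Only the power $k=|e|/2$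
    contributes; its $q$-multinomial coefficient cancels $(q^4;q^4)_k$, and [binom2_sum] separates
    the variables. *)
Lemma gauss_sum_coef (e : expo n) :
  (series_at (E_coef (p ^+ 4)) (- (p ^+ 4 *: \sum_(j < n) xA j ^+ 2))) e =
  p ^+ (\sum_(i < n) \sum_(j < n | (j < i)%N) e i * e j)%N * \prod_j wcoef (e j).
Proof.
rewrite -scaleNr; set y := \sum_(j < n) _.
have E k : ((- p ^+ 4 *: y) ^+ k) e = (- p ^+ 4) ^+ k * (y ^+ k) e.
  by rewrite exprZn.
transitivity (\sum_(k < (expo_deg e).+1) E_coef (p ^+ 4) k * ((- p ^+ 4) ^+ k *
    (if [forall j, ~~ odd (e j)] && (expo_deg e == 2 * k)%N
     then qpoch (p ^+ 4) (p ^+ 4) k / \prod_j qpoch (p ^+ 4) (p ^+ 4) (e j)./2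
     else 0))).
  by apply: eq_bigr => k _; rewrite -sum_sqr_exp -E.
case: (boolP [forall j, ~~ odd (e j)]) => [ev|nev]; last first.
  rewrite big1 => [|k _]; last by rewrite !mulr0.
  move: nev; rewrite negb_forall => /existsP[j]; rewrite negbK => oj.
  by rewrite [X in _ * X](bigD1 j) //= {1}/wcoef oj mul0r mulr0.
have e2m j : e j = (2 * (e j)./2)%N.
  by rewrite mul2n -[LHS]odd_double_half; have /forallP/(_ j)/negbTE-> := ev.
pose k := (\sum_j (e j)./2)%N.
have dg : expo_deg e = (2 * k)%N.
  by rewrite big_distrr /=; apply: eq_bigr => j _; rewrite -e2m.
have lt : (k < (expo_deg e).+1)%N by rewrite dg ltnS mul2n -addnn leq_addr.
rewrite (bigD1 (Ordinal lt)) //= [X in _ + X]big1 ?addr0; last first.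
  move=> l /negP nl; case: eqP => [h|]; last by rewrite !mulr0.
  case: nl; apply/eqP/val_inj => /=; apply/eqP; rewrite -(eqn_pmul2l (m := 2)) //.
  by rewrite -h dg.
rewrite dg eqxx.
have D0 : \prod_j qpoch (p ^+ 4) (p ^+ 4) (e j)./2 != 0.
  by apply/prodf_neq0 => j _; exact: qpoch_neq0.
have K0 := qpoch_neq0 k (isT : (0 < 4)%N).
rewrite /E_coef -bin2.
have -> : \prod_j wcoef (e j) = (p ^+ 4) ^+ (\sum_j 'C((e j)./2, 2)) * (- p ^+ 4) ^+ k /
    \prod_j qpoch (p ^+ 4) (p ^+ 4) (e j)./2.
  rewrite !expr_sum -prodfV -!big_split /=; apply: eq_bigr => j _.
  rewrite /wcoef; have /forallP/(_ j)/negbTE-> := ev.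
  by rewrite /E_coef -bin2 mulrAC.
have -> : (\sum_(i < n) \sum_(j < n | (j < i)%N) e i * e j =
    4 * \sum_(i < n) \sum_(j < n | (j < i)%N) (e i)./2 * (e j)./2)%N.
  rewrite big_distrr /=; apply: eq_bigr => i _; rewrite big_distrr /=.
  by apply: eq_bigr => j _; rewrite {1}(e2m i) {1}(e2m j) mulnACA.
rewrite binom2_sum exprM exprD.
by field; rewrite K0 D0.
Qed.

End QCoefficients.

(** * Jackson integrals in one variable *)

Section OneVariable.
Variable R : realType.
Implicit Types (c : nat -> R[i]) (z s : R[i]).

Definition entire1 c := forall z, abs_summable (fun m => c m * z ^+ m).

Definition value1 c z : R[i] := csum (fun m => c m * z ^+ m).

Lemma value1P c z : entire1 c -> has_sum (fun m => c m * z ^+ m) (value1 c z).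
Proof. by move=> ec; split. Qed.

Lemma has_sum_shift k c z s : has_sum (fun m => c m * z ^+ m) s ->
  has_sum (fun m => shift k c m * z ^+ m) (z ^+ k * s).
Proof.
move=> /(has_sumZ (z ^+ k)) h; have finj : injective (addn k) by apply: addnI.
apply/(has_sum_inj _ finj).
  move=> m km; rewrite /shift; case: leqP => // le; last by rewrite mul0r.
  by have := km (m - k)%N; rewrite subnKC ?eqxx.
apply: eq_has_sum h => m; rewrite /shift leq_addr addKn exprD; ring.
Qed.

Lemma shift_shift d k c : shift d (shift k c) = shift (d + k) c.
Proof.
apply: funext => m; rewrite /shift; case: (leqP d m) => dm.
  by rewrite subnDA; congr (if _ then _ else _); lia.
by case: leqP => //; lia.
Qed.

Lemma entire1_shift k c : entire1 c -> entire1 (shift k c).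
Proof. by move=> ec z; have [] := has_sum_shift k (value1P z ec). Qed.

Lemma value1_shift k c z : entire1 c -> value1 (shift k c) z = z ^+ k * value1 c z.
Proof. by move=> ec; have [_ ->] := has_sum_shift k (value1P z ec). Qed.

Lemma has_sum_lin (K : finType) (h : K -> R[i]) (c : K -> nat -> R[i]) z :
  (forall k, entire1 (c k)) ->
  has_sum (fun m => (\sum_k h k * c k m) * z ^+ m) (\sum_k h k * value1 (c k) z).
Proof.
move=> ec; apply: (@eq_has_sum _ _ (fun m => \sum_k h k * (c k m * z ^+ m))).
  by move=> m; rewrite mulr_suml; apply: eq_bigr => k _; rewrite mulrA.
by apply: has_sum_big => k _; apply: has_sumZ; exact: value1P.
Qed.

Lemma normc_csum_le (I : choiceType) (u : I -> R[i]) : abs_summable u ->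
  normc (csum u) <= fine (nsum (fun i => normc (u i))) *+ 2.
Proof.
move=> su; apply: le_trans (le_normc_ReIm _) _; rewrite mulr2n /csum /=.
have /abs_summableE nu := su; have u0 i : 0 <= normc (u i) by exact: normc_ge0.
have sR := summable_Re su; have sI := summable_Im su.
apply: lerD.
  apply: le_trans (normr_rsum_le sR) _; rewrite -lee_fin (nsum_fin u0 nu).
  by rewrite nsum_fin //; apply: le_nsum => i; exact: normRe_le.
apply: le_trans (normr_rsum_le sI) _; rewrite -lee_fin (nsum_fin u0 nu).
by rewrite nsum_fin //; apply: le_nsum => i; exact: normIm_le.
Qed.

(** The closed unit disc contains all lattice points with non-negative index, so this bound controls
    the Jackson sum. The doubling comes from [normc_csum_le]. *)
Lemma value1_bounded c : entire1 c ->
  exists2 B : R, 0 <= B & forall z, normc z <= 1 -> normc (value1 c z) <= B.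
Proof.
move=> ec; pose B := fine (nsum (fun m => normc (c m))).
have c0 m : 0 <= normc (c m) by exact: normc_ge0.
have cs : (nsum (fun m => normc (c m)) < +oo)%E.
  have /abs_summableE := ec 1; congr (_ < +oo)%E; congr nsum; apply: funext => m.
  by rewrite expr1n mulr1.
exists (B *+ 2); first by rewrite mulrn_wge0 // fine_ge0 // nsum_ge0.
move=> z z1; apply: le_trans (normc_csum_le (ec z)) _.
have z0 m : 0 <= normc (c m * z ^+ m) by exact: normc_ge0.
have /abs_summableE zs := ec z.
rewrite lerMn2r /= -lee_fin (nsum_fin z0 zs) (nsum_fin c0 cs).
apply: le_nsum => m; rewrite ComplexField.Normc.normcM normcX ler_piMr //.
by rewrite exprn_ile1 // normc_ge0.
Qed.

Lemma nsum_fin_type (I : finType) (a : I -> R) : (forall i, 0 <= a i) ->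
  (nsum a < +oo)%E.
Proof.
move=> a0; apply: (@le_lt_trans _ _ (\sum_i a i)%:E); last by rewrite ltry.
apply: nsum_le_bound => // F.
have -> : \sum_(i <- F) a i = \sum_(i | i \in F) a i.
  rewrite -[RHS]big_filter; apply: perm_big.
  apply: uniq_perm; rewrite ?fset_uniq ?filter_uniq ?index_enum_uniq //.
  by move=> i; rewrite mem_filter mem_index_enum andbT.
by rewrite big_mkcond ler_sum // => i _; case: ifP.
Qed.

End OneVariable.

(** * The Jackson integral over the lattice $\pm q^{2\mathbb Z}$ *)

Section Lattice.
Variables (R : realType) (q : R).
Hypothesis q01 : 0 < q < 1.
Local Notation p := (q%:C).
Implicit Types (c : nat -> R[i]) (z : R[i]).

Let q0 : 0 < q. Proof. by case/andP: q01. Qed.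
Let q1 : q < 1. Proof. by case/andP: q01. Qed.
Let qn0 : q != 0. Proof. exact: lt0r_neq0. Qed.
Let pn0 : p != 0. Proof. exact: p_neq0. Qed.

(** The ratio of consecutive coefficients; it yields both the entirety and the functional equation
    of the Gaussian. *)
Lemma E_coef_rec k :
  E_coef (p ^+ 4) k.+1 * (1 - (p ^+ 4) ^+ k.+1) = (p ^+ 4) ^+ k * E_coef (p ^+ 4) k.
Proof.
rewrite /E_coef qpochS -exprS -!bin2 binS bin1 exprD.
have h1 := qpoch_neq0 q01 k (isT : (0 < 4)%N).
have h2 : 1 - (p ^+ 4) ^+ k.+1 != 0 by rewrite -exprM one_sub_pX_neq0.
by field; rewrite h1 h2.
Qed.

Lemma wcoef_odd m : odd m -> wcoef q m = 0.
Proof. by rewrite /wcoef => ->. Qed.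

(** Along even exponents, consecutive terms have a ratio of order $q^{4k}|z|^2$, so [ratio_summable]
    applies. *)
Lemma wcoef_entire : entire1 (wcoef q).
Proof.
move=> z; have dinj : injective double by exact: double_inj.
suff : has_sum (fun m => wcoef q m * z ^+ m)
    (csum (fun k => wcoef q k.*2 * z ^+ k.*2)) by case.
apply/(has_sum_inj _ dinj).
  move=> m hm; rewrite /wcoef; case: ifPn => [_|ev]; first by rewrite mul0r.
  by have := hm m./2; rewrite even_halfK // eqxx.
split => //; apply/abs_summableE.
pose P := q ^+ 4.
have P0 : 0 <= P by rewrite exprn_ge0 // ltW.
have P1 : P < 1 by rewrite exprn_ilt1 // ltW.
pose B := P * normc z ^+ 2 / (1 - P).
apply: (@ratio_summable _ P B); first by rewrite P0.
- apply: divr_ge0; last by rewrite subr_ge0 ltW.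
  by rewrite mulr_ge0 // exprn_ge0 // normc_ge0.
- by move=> k; exact: normc_ge0.
move=> k.
have wE l : wcoef q l.*2 = E_coef (p ^+ 4) l * (- p ^+ 4) ^+ l.
  by rewrite /wcoef odd_double doubleK.
have -> : wcoef q k.+1.*2 * z ^+ k.+1.*2 =
   (1 - (p ^+ 4) ^+ k.+1)^-1 * (p ^+ 4) ^+ k * (- p ^+ 4) * z ^+ 2 * (wcoef q k.*2 * z ^+ k.*2).
  rewrite !wE (_ : z ^+ k.+1.*2 = z ^+ k.*2 * z ^+ 2); last by rewrite -exprD addn2.
  rewrite (exprS (- p ^+ 4)).
  have h2 : 1 - (p ^+ 4) ^+ k.+1 != 0 by rewrite -exprM one_sub_pX_neq0.
  have -> : E_coef (p ^+ 4) k.+1 = (p ^+ 4) ^+ k * E_coef (p ^+ 4) k / (1 - (p ^+ 4) ^+ k.+1).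
    by rewrite -E_coef_rec mulfK.
  ring.
rewrite ComplexField.Normc.normcM; apply: ler_wpM2r; first exact: normc_ge0.
rewrite !ComplexField.Normc.normcM !normcX ComplexField.Normc.normcV.
have -> : normc (- p ^+ 4) = P.
  by rewrite -rmorphXn -rmorphN normc_real normrN ger0_norm.
have -> : normc p ^+ 4 = P by rewrite normc_real ger0_norm // ltW.
have -> : normc (1 - (p ^+ 4) ^+ k.+1) = 1 - P ^+ k.+1.
  rewrite -!rmorphXn -[1]/((1 : R)%:C) -rmorphB normc_real ger0_norm //.
  by rewrite subr_ge0 exprn_ile1 // ltW.
rewrite /B (_ : (_ * _ * _ * _) = P ^+ k * (P * normc z ^+ 2 / (1 - P ^+ k.+1))); last by ring.
apply: ler_wpM2l; first exact: exprn_ge0.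
apply: ler_wpM2l.
  by apply: mulr_ge0 => //; apply: exprn_ge0; exact: normc_ge0.
have PS : P ^+ k.+1 < 1 by rewrite exprn_ilt1.
rewrite lef_pV2 ?posrE ?subr_gt0 //.
by rewrite lerD2l lerN2 exprS ler_piMr // exprn_ile1 // ltW.
Qed.

(* [E_(q^4)(- z^2) = (1 - z^2) E_(q^4)(- q^4 z^2)]. *)
Lemma wfun_eq z : value1 (wcoef q) (z / p ^+ 2) = (1 - z ^+ 2) * value1 (wcoef q) z.
Proof.
have h := value1P z wcoef_entire.
have h2 := has_sumD h (has_sumZ (-1) (has_sum_shift 2 h)).
rewrite mulrDl mul1r mulNr -mulN1r; apply: has_sum_unique (value1P _ wcoef_entire) _.
apply: eq_has_sum h2 => m; rewrite /shift.
have [om|ev] := boolP (odd m).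
  rewrite wcoef_odd // !mul0r add0r; case: (leqP 2 m) => m2.
    by rewrite wcoef_odd ?oddB ?om // mul0r mulr0.
  by rewrite mul0r mulr0.
have -> : m = (m./2).*2 by rewrite even_halfK.
move: (m./2) => k {m ev}; case: k => [|k].
  by rewrite /= !expr0 mul0r mulr0 addr0.
rewrite (_ : (k.+1.*2 - 2 = k.*2)%N) ?doubleS; last by lia.
rewrite /= -doubleS /wcoef odd_double doubleK /= odd_double doubleK /=.
have h2' : 1 - (p ^+ 4) ^+ k.+1 != 0 by rewrite -exprM one_sub_pX_neq0.
have -> : E_coef (p ^+ 4) k.+1 = (p ^+ 4) ^+ k * E_coef (p ^+ 4) k / (1 - (p ^+ 4) ^+ k.+1).
  by rewrite -E_coef_rec mulfK.
rewrite expr_div_n (_ : (p ^+ 2) ^+ k.+1.*2 = (p ^+ 4) ^+ k.+1); last first.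
  by rewrite -!exprM; congr (_ ^+ _); lia.
have P0 : p ^+ 4 != 0 by rewrite expf_neq0.
move: (p ^+ 4) P0 h2' (E_coef _ _) (z ^+ _) => P P0 h2' E Z.
rewrite (exprNn P k.+1) (exprNn P k) !exprS; move: h2'; rewrite exprS => h2'.
have PX : P ^+ k != 0 by rewrite expf_neq0.
by field; rewrite PX P0 h2'.
Qed.

(** The lattice without the scale $\gamma_l$: integrating out a variable always brings its argument
    back to these points. *)
Definition lat (x : int * bool) : R[i] := ((-1) ^+ x.2 * q ^ (2%:Z * x.1))%:C.

Lemma lat_pred h eps : lat (h - 1, eps) = lat (h, eps) / p ^+ 2.
Proof.
rewrite /lat /= -rmorphXn -fmorphV -rmorphM /=; congr _%:C.
by rewrite mulrBr mulr1 expfzDr // -!mulrA; congr (_ * (_ * _)).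
Qed.

Lemma lat_sqr0 eps : lat (0, eps) ^+ 2 = 1.
Proof. by rewrite /lat /= mulr0 expr0z mulr1 -rmorphXn /= sqrr_sign. Qed.

(** At $z=\pm1$ the factor $1-z^2$ of the functional equation vanishes, giving the zero at $\pm
    q^{-2}$; the same equation carries it to $\pm q^{-4}$ and further out. *)
Lemma wfun_lat_neg h eps : h < 0 -> value1 (wcoef q) (lat (h, eps)) = 0.
Proof.
case: h => // k _; rewrite NegzE; elim: k => [|k IH].
  by rewrite -[- 1%:Z]add0r lat_pred wfun_eq lat_sqr0 subrr mul0r.
have -> : - k.+2%:Z = - k.+1%:Z - 1 by lia.
by rewrite lat_pred wfun_eq IH mulr0.
Qed.

(** The factor $1-q^2$ is left out here and restored in [partial_integral_gauss]. *)
Definition jackson_term c (x : int * bool) : R[i] :=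
  (q ^ (2%:Z * x.1))%:C * value1 c (lat x).

Definition jackson c : R[i] := csum (jackson_term c).

(** The vanishing condition makes the bilateral sum over $h$ effectively one-sided, which gives
    convergence. *)
Definition jackson_ok c := entire1 c /\ forall h eps, h < 0 -> value1 c (lat (h, eps)) = 0.

Lemma normc_lat x : normc (lat x) = q ^ (2%:Z * x.1).
Proof.
rewrite /lat normc_real normrM normrX normrN1 expr1n mul1r ger0_norm //.
by rewrite exprz_ge0 // ltW.
Qed.

(** Only indices $h\ge0$ contribute; there the values are bounded and the weights $q^{2h}$ form a
    geometric sequence. *)
Lemma jackson_summable c : jackson_ok c -> abs_summable (jackson_term c).
Proof.
move=> [ec c0].
have [B B0 cB] := value1_bounded ec.
pose f (x : bool * nat) : int * bool := (x.2%:Z, x.1).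
have finj : injective f by move=> [? ?] [? ?] [-> ->].
suff : has_sum (jackson_term c) (csum (fun x => jackson_term c (f x))) by case.
apply/(has_sum_inj _ finj).
  move=> [[k|k] eps] hx; first by have := hx (eps, k); rewrite eqxx.
  by rewrite /jackson_term c0 ?mulr0.
split => //.
have geo : (nsum (fun k : nat => ((q ^+ 2) ^+ k * B)%R) < +oo)%E.
  have P0 : 0 <= q ^+ 2 by rewrite exprn_ge0 // ltW.
  have P1 : q ^+ 2 < 1 by rewrite exprn_ilt1 // ltW.
  apply: (@le_lt_trans _ _ (B / (1 - q ^+ 2))%:E); last by rewrite ltry.
  apply: nsum_nat_le => [k|N]; first by rewrite mulr_ge0 // exprn_ge0.
  rewrite -mulr_suml mulrC ler_wpM2l // -[leRHS]div1r ler_pdivlMr ?subr_gt0 //.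
  rewrite mulrC -opprB mulNr -subrX1 opprB lerBlDr lerDl; exact: exprn_ge0.
have geo0 k : 0 <= (q ^+ 2) ^+ k * B by rewrite mulr_ge0 // exprn_ge0 // exprn_ge0 // ltW.
apply: (@abs_summable_pair _ _ _ _ (fun=> fine (nsum (fun k : nat => ((q ^+ 2) ^+ k * B)%R)))).
  move=> eps; rewrite (nsum_fin geo0 geo); apply: le_nsum => k.
  rewrite -[jackson_term _ _]/((q ^ (2%:Z * k%:Z))%:C * value1 c (lat (k%:Z, eps))).
  rewrite ComplexField.Normc.normcM normc_real.
  rewrite (_ : q ^ _ = (q ^+ 2) ^+ k) ?ger0_norm; last 2 first.
  - by rewrite exprn_ge0 // exprn_ge0 // ltW.
  - by rewrite -exprM -exprnP.
  apply: ler_wpM2l; first by rewrite exprn_ge0 // exprn_ge0 // ltW.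
  apply: cB; rewrite normc_lat /= (_ : q ^ _ = q ^+ (2 * k)) //.
  by rewrite exprn_ile1 // ltW.
by apply: nsum_fin_type => _; rewrite fine_ge0 // nsum_ge0.
Qed.

Lemma jacksonP c : jackson_ok c -> has_sum (jackson_term c) (jackson c).
Proof. by move=> /jackson_summable; split. Qed.

Lemma jackson_ok_w m : jackson_ok (shift m (wcoef q)).
Proof.
split; first by apply: entire1_shift; exact: wcoef_entire.
move=> h eps h0; rewrite value1_shift ?wfun_lat_neg ?mulr0 //; exact: wcoef_entire.
Qed.

Section LinearCombination.
Variables (K : finType) (h : K -> R[i]) (c : K -> nat -> R[i]).
Hypothesis ok : forall k, jackson_ok (c k).

Lemma value1_lin z :
  value1 (fun m => \sum_k h k * c k m) z = \sum_k h k * value1 (c k) z.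
Proof.
by have [_ ->] := has_sum_lin h z (fun k => (ok k).1).
Qed.

Lemma jackson_ok_lin : jackson_ok (fun m => \sum_k h k * c k m).
Proof.
split; first by move=> z; have [] := has_sum_lin h z (fun k => (ok k).1).
move=> l eps l0; rewrite value1_lin big1 // => k _.
by rewrite (ok k).2 ?mulr0.
Qed.

Lemma jackson_lin : jackson (fun m => \sum_k h k * c k m) = \sum_k h k * jackson (c k).
Proof.
apply: has_sum_unique (jacksonP jackson_ok_lin) _.
apply: (@eq_has_sum _ _ (fun x => \sum_k h k * jackson_term (c k) x)).
  move=> x; rewrite /jackson_term value1_lin mulr_sumr.
  by apply: eq_bigr => k _; rewrite mulrCA.
by apply: has_sum_big => k _; apply: has_sumZ; apply: jacksonP.
Qed.

End LinearCombination.

Definition moment m := jackson (shift m (wcoef q)).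

Lemma jackson_term_w m x : jackson_term (shift m (wcoef q)) x =
  (q ^ (2%:Z * x.1))%:C * (lat x ^+ m * value1 (wcoef q) (lat x)).
Proof. by rewrite /jackson_term value1_shift //; exact: wcoef_entire. Qed.

(* Shifting the lattice by one step and using [wfun_eq]. *)
Lemma moment_rec m : moment m.+2 = (1 - (p ^+ 2) ^+ m.+1) * moment m.
Proof.
have h0 := jacksonP (jackson_ok_w m); have h2 := jacksonP (jackson_ok_w m.+2).
pose f (x : int * bool) : int * bool := (x.1 - 1, x.2).
have finj : injective f.
  by move=> [a b] [a' b']; rewrite /f /= => -[e ->]; congr (_, _); lia.
have hf : has_sum (fun x => jackson_term (shift m (wcoef q)) (f x)) (moment m).
  refine (proj1 (has_sum_inj (u := jackson_term (shift m (wcoef q))) _ finj _) h0).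
  by move=> [a b] /(_ (a + 1, b)); rewrite /f /= addrK eqxx.
have P0 : (p ^+ 2) ^+ m.+1 != 0 by rewrite !expf_neq0.
(* By the functional equation, the term of moment [m] at index $h-1$ is $q^{-2(m+1)}$ times the
   difference of the terms of moments [m] and [m.+2] at index $h$. *)
suff : (p ^+ 2) ^- m.+1 * (moment m + -1 * moment m.+2) = moment m.
  move/(congr1 (fun t => (p ^+ 2) ^+ m.+1 * t)); rewrite mulrA mulfV // mul1r => e'.
  by rewrite mulrBl mul1r -e' mulN1r opprB addrC subrK.
apply: has_sum_unique hf.
apply: eq_has_sum (has_sumZ ((p ^+ 2) ^- m.+1) (has_sumD h0 (has_sumZ (-1) h2))) => -[l eps].
rewrite !jackson_term_w -![(_, _).1]/(_) -[f _]/(l - 1, eps) lat_pred wfun_eq.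
rewrite mulrBr mulr1 expfzDr // rmorphM /=.
have -> : (q ^ (- 2%:Z))%:C = (p ^+ 2)^-1 by rewrite -rmorphXn -fmorphV.
rewrite expr_div_n (exprS (p ^+ 2)) -[m.+2]addn2 exprD.
have h1 : (p ^+ 2) ^+ m != 0 by rewrite !expf_neq0.
have h3 : p ^+ 2 != 0 by rewrite !expf_neq0.
move: (p ^+ 2) h1 h3 => P h1 h3.
by field; rewrite h1 h3.
Qed.

Lemma wfun_even z : value1 (wcoef q) (- z) = value1 (wcoef q) z.
Proof.
rewrite /value1; congr csum; apply: funext => m.
have [om|ev] := boolP (odd m); first by rewrite wcoef_odd // !mul0r.
by rewrite -[in LHS](even_halfK ev) -[in RHS](even_halfK ev) -!mul2n !exprM sqrrN.
Qed.

(** Exchanging the two signs of the lattice permutes the summands and negates each of them. *)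
Lemma moment_odd m : odd m -> moment m = 0.
Proof.
move=> om; have h0 := jacksonP (jackson_ok_w m).
pose f (x : int * bool) : int * bool := (x.1, ~~ x.2).
have finj : injective f by move=> [a b] [a' b'] [-> /negb_inj->].
have hf : has_sum (fun x => jackson_term (shift m (wcoef q)) (f x)) (moment m).
  refine (proj1 (has_sum_inj (u := jackson_term (shift m (wcoef q))) _ finj _) h0).
  by move=> [a b] /(_ (a, ~~ b)); rewrite /f /= negbK eqxx.
have hN : has_sum (fun x => jackson_term (shift m (wcoef q)) (f x)) (-1 * moment m).
  apply: eq_has_sum (has_sumZ (-1) h0) => -[a b]; rewrite !jackson_term_w -[f _]/(a, ~~ b).
  have -> : lat (a, ~~ b) = - lat (a, b).
    by rewrite /lat /= -rmorphN -mulNr; case: b; rewrite /= ?expr0 ?expr1 ?opprK.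
  rewrite wfun_even exprNn -signr_odd om expr1; ring.
have := has_sum_unique hf hN; rewrite mulN1r => /eqP.
by rewrite -subr_eq0 opprK -mulr2n mulrn_eq0 => /eqP.
Qed.

End Lattice.

(** * Moments of the discrete Hermite polynomials *)

Section HermiteMoments.
Variables (R : realType) (q : R).
Hypothesis q01 : 0 < q < 1.
Local Notation p := (q%:C).
Local Notation P2 := (p ^+ 2).
Local Notation P4 := (p ^+ 4).
Variable Mo : nat -> R[i].
Hypothesis Mo_rec : forall m, Mo m.+2 = (1 - P2 ^+ m.+1) * Mo m.
Hypothesis Mo_odd : forall m, odd m -> Mo m = 0.

(** Extension by zero: the subtraction in [hcoef] truncates, so [hcoef] itself does not vanish for
    $2k>a$. *)
Definition hx a k : R[i] := if (2 * k <= a)%N then hcoef q a k else 0.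

(** When [Mo] gives the moments of the Gaussian, this is the Jackson integral of $z^d h_a(z;q^2)$
    against it. *)
Definition hermite_moment a d : R[i] := \sum_(k < a./2.+1) hcoef q a k * Mo (d + (a - 2 * k)).

Let hermite_momentE N a d : (a./2 < N)%N ->
  hermite_moment a d = \sum_(k < N) hx a k * Mo (d + (a - 2 * k)).
Proof.
move=> aN; rewrite /hermite_moment.
rewrite (big_ord_widen _ (fun k => hcoef q a k * Mo (d + (a - 2 * k))) aN).
rewrite big_mkcond /=; apply: eq_bigr => k _; rewrite /hx.
by case: (ltnP k a./2.+1) => h1; case: (leqP (2 * k) a) => h2; rewrite ?mul0r //; lia.
Qed.

Lemma hcoef0 a : hcoef q a 0 = 1.
Proof.
rewrite /hcoef mul0n !muln0 subn0 qpoch0 !expr0 !mul1r mulfV //.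
by rewrite (qpoch_neq0 q01).
Qed.

(* Coefficientwise three-term recurrence of the discrete Hermite polynomials. *)
Lemma hx_rec a k : hx a.+2 k.+1 = hx a.+1 k.+1 - P2 ^+ a * (1 - P2 ^+ a.+1) * hx a k.
Proof.
rewrite /hx; case: (leqP (2 * k) a) => ka; last first.
  by rewrite !ifF ?mulr0 ?subr0 //; apply/negbTE; lia.
rewrite ifT; last by lia.
have [r ->] : exists r, a = (2 * k + r)%N by exists (a - 2 * k)%N; lia.
have n2 m : qpoch P2 P2 m != 0 by rewrite qpoch_neq0.
have n4 m : qpoch P4 P4 m != 0 by rewrite qpoch_neq0.
have eX : p ^+ (2 * (k.+1 * k.+1.-1)) = p ^+ (2 * (k * k.-1)) * P4 ^+ k.
  by rewrite -exprM -exprD; congr (_ ^+ _); case: (k) => // m /=; lia.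
(* For $r=0$ the index [k.+1] is out of range; the factor $1-q^{2r}$ makes the closed form vanish
   there too. *)
have -> : (if (2 * k.+1 <= (2 * k + r).+1)%N then hcoef q (2 * k + r).+1 k.+1 else 0) =
    qpoch P2 P2 (2 * k + r).+1 * ((-1) ^+ k.+1 * p ^+ (2 * (k.+1 * k.+1.-1))) /
    qpoch P4 P4 k.+1 * (1 - P2 ^+ r) / qpoch P2 P2 r.
  case: r => [|r].
    by rewrite ifF ?expr0 ?subrr ?mulr0 ?mul0r //; apply/negbTE; lia.
  rewrite ifT; last by lia.
  rewrite /hcoef (_ : ((2 * k + r.+1).+1 - 2 * k.+1 = r)%N); last by lia.
  have := n2 r.+1; have := n2 r; have := n4 k.+1; rewrite (qpochS P2 P2 r) -exprS.
  by rewrite mulf_eq0 negb_or => h1 h2 /andP[_ h3]; field; rewrite h1 h2 h3.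
rewrite /hcoef (_ : ((2 * k + r).+2 - 2 * k.+1 = r)%N); last by lia.
rewrite (_ : (2 * k + r - 2 * k = r)%N); last by lia.
rewrite eX !qpochS -!exprS.
have e1 : P2 ^+ (2 * k + r) = P4 ^+ k * P2 ^+ r.
  by rewrite exprD exprM -[P2 ^+ 2]exprM.
have h2 := n2 r; have h4 := n4 k.
have h5 : 1 - P4 ^+ k.+1 != 0 by rewrite -exprM one_sub_pX_neq0.
rewrite !(exprS P2) e1 (exprS P4) (exprS (-1)).
rewrite (exprS P4) in h5.
have e4 : P4 = P2 * P2 by rewrite -exprD.
move: (qpoch P2 P2 (2 * k + r)) (qpoch P2 P2 r) (qpoch P4 P4 k) h2 h4 => Z A B h2 h4.
move: (p ^+ (2 * (k * k.-1))) ((-1) ^+ k) (P4 ^+ k) (P2 ^+ r) h5 => U V X Y.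
rewrite e4; move: P2 => T h5.
by field; rewrite h5 h2 h4.
Qed.

(** The relation $h_{a+2}=z\,h_{a+1}-q^{2a}(1-q^{2a+2})h_a$ under the integral, where multiplication
    by $z$ raises [d] by one. The leading coefficients agree, so only the indices $k+1$ need
    [hx_rec]. *)
Let hermite_moment_rec a d :
  hermite_moment a.+2 d =
  hermite_moment a.+1 d.+1 - P2 ^+ a * (1 - P2 ^+ a.+1) * hermite_moment a d.
Proof.
have bigS (F : nat -> R[i]) N : \sum_(k < N.+1) F k = F 0%N + \sum_(k < N) F k.+1.
  by rewrite big_ord_recl.
rewrite (@hermite_momentE (a./2.+2) a.+2); last by rewrite /=; lia.
rewrite (@hermite_momentE (a./2.+2) a.+1); last by lia.
rewrite (@hermite_momentE (a./2.+1) a) //.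
set c := P2 ^+ a * _.
pose A k := hx a.+1 k * Mo (d.+1 + (a.+1 - 2 * k)).
rewrite (bigS (fun k => hx a.+2 k * Mo (d + (a.+2 - 2 * k)))) (bigS A).
have -> : hx a.+2 0 * Mo (d + (a.+2 - 2 * 0)) = A 0%N.
  by rewrite /A /hx muln0 !leq0n !hcoef0 !subn0 addSnnS.
rewrite mulr_sumr -addrA -sumrB; congr (A 0%N + _); apply: eq_bigr => k _.
rewrite hx_rec mulrBl (_ : (a.+2 - 2 * k.+1 = a - 2 * k)%N); last by lia.
suff -> : hx a.+1 k.+1 * Mo (d + (a - 2 * k)) = A k.+1 by rewrite -/c -(mulrA c).
rewrite /A /hx; case: (leqP (2 * k.+1) a.+1) => h; last by rewrite !mul0r.
by congr (_ * Mo _); lia.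
Qed.

(** The closed form $q^{a(a-1)}M_0\,(q^2;q^2)_d/(q^4;q^4)_{(d-a)/2}$. Its vanishing for $d<a$ is the
    orthogonality of $h_a$ to lower powers. *)
Definition hermite_value a d : R[i] :=
  if (a <= d)%N && ~~ odd (d - a)
  then p ^+ (2 * 'C(a, 2)) * Mo 0 * qpoch P2 P2 d / qpoch P4 P4 (d - a)./2
  else 0.

Let moment_value d : Mo d = hermite_value 0 d.
Proof.
rewrite /hermite_value leq0n subn0 bin0n muln0 expr0 mul1r /=.
case: (boolP (odd d)) => [od|ev] /=; first exact: Mo_odd.
have -> : d = (d./2).*2 by rewrite even_halfK.
move: (d./2) => k {d ev}; rewrite doubleK; elim: k => [|k IH].
  by rewrite !qpoch0 divr1 mulr1.
rewrite doubleS Mo_rec IH !qpochS -!exprS.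
have -> : P2 ^+ k.*2.+2 = P4 ^+ k.+1 by rewrite -!exprM; congr (_ ^+ _); lia.
have h4 : qpoch P4 P4 k != 0 by rewrite qpoch_neq0.
have h5 : 1 - P4 ^+ k.+1 != 0 by rewrite -exprM one_sub_pX_neq0.
move: (qpoch P4 P4 k) (P4 ^+ k.+1) h4 h5 => B X h4 h5.
move: (P2 ^+ k.*2.+1) (qpoch P2 P2 k.*2) => T U.
by field; rewrite h5 h4.
Qed.

Let hermite_value1 d : Mo d.+1 = hermite_value 1 d.
Proof.
rewrite moment_value /hermite_value subn0 !leq0n /=.
case: d => [|d] //; rewrite subn1 /= negbK.
case: (boolP (odd d)) => //= ev.
have -> : d = (d./2).*2 by rewrite even_halfK.
move: (d./2) => k {d ev}; rewrite -doubleS !doubleK doubleS !qpochS -!exprS.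
have -> : P2 ^+ k.*2.+2 = P4 ^+ k.+1 by rewrite -!exprM; congr (_ ^+ _); lia.
have h4 : qpoch P4 P4 k != 0 by rewrite qpoch_neq0.
have h5 : 1 - P4 ^+ k.+1 != 0 by rewrite -exprM one_sub_pX_neq0.
rewrite !bin_small //.
move: (qpoch P4 P4 k) (P4 ^+ k.+1) h4 h5 => B X h4 h5.
move: (P2 ^+ k.*2.+1) (qpoch P2 P2 k.*2) => T U.
by field; rewrite h5 h4.
Qed.

Let hermite_value_rec a d :
  hermite_value a.+2 d = hermite_value a.+1 d.+1 - P2 ^+ a * (1 - P2 ^+ a.+1) * hermite_value a d.
Proof.
have h4 m : qpoch P4 P4 m != 0 by rewrite qpoch_neq0.
rewrite /hermite_value ltnS subSS.
case: (leqP a d) => ad; last by rewrite !ifF ?mulr0 ?subr0 //; apply/negbTE; lia.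
have [r ->] : exists r, d = (a + r)%N by exists (d - a)%N; lia.
rewrite addKn; case: (boolP (odd r)) => [or|ev] /=.
  by rewrite ifF ?mulr0 ?subr0 //; apply/negbTE; lia.
have [k ->] : exists k, r = k.*2 by exists r./2; rewrite even_halfK.
rewrite doubleK qpochS -exprS.
have -> : p ^+ (2 * 'C(a.+1, 2)) = p ^+ (2 * 'C(a, 2)) * P2 ^+ a.
  by rewrite binS bin1 -exprM -exprD; congr (_ ^+ _); lia.
case: k => [|k].
  rewrite ifF; last by apply/negbTE; lia.
  by rewrite double0 addn0; ring.
rewrite ifT; last by apply/andP; split; lia.
have -> : ((a + k.+1.*2 - a.+2)./2 = k)%N by lia.
have -> : p ^+ (2 * 'C(a.+2, 2)) = p ^+ (2 * 'C(a, 2)) * P2 ^+ a * P2 ^+ a.+1.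
  rewrite (binS a.+1) (binS a) !bin1 -!exprM -!exprD; congr (_ ^+ _); lia.
have -> : P2 ^+ (a + k.+1.*2).+1 = P2 ^+ a.+1 * P4 ^+ k.+1.
  by rewrite -!exprM -!exprD; congr (_ ^+ _); lia.
rewrite qpochS -exprS.
have h5 : 1 - P4 ^+ k.+1 != 0 by rewrite -exprM one_sub_pX_neq0.
have := h4 k; move: (qpoch P4 P4 k) (P4 ^+ k.+1) h5 => B X h5 hB.
move: (P2 ^+ a.+1) (P2 ^+ a) (qpoch P2 P2 (a + k.+1.*2)) => T U V.
by field; rewrite h5 hB.
Qed.

(** Both sides satisfy the same three-term recurrence in [a] and agree for $a=0,1$ and all [d];
    hence an induction on two consecutive values of [a]. *)
Lemma hermite_moment_value a d : hermite_moment a d = hermite_value a d.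
Proof.
suff : (forall d, hermite_moment a d = hermite_value a d) /\
    (forall d, hermite_moment a.+1 d = hermite_value a.+1 d) by case.
elim: a {d} => [|a [IH0 IH1]].
  split=> d; rewrite /hermite_moment big_ord1 hcoef0 mul1r; first by rewrite addn0 moment_value.
  by rewrite muln0 subn0 addn1 hermite_value1.
by split=> // d; rewrite hermite_moment_rec IH0 IH1 hermite_value_rec.
Qed.

End HermiteMoments.

(** * Jackson integrals of a monomial times Gaussian times Hermite polynomial *)

Section GaussHermite.
Variables (R : realType) (q : R).
Hypothesis q01 : 0 < q < 1.

Lemma shift_ucoef d a : shift d (ucoef q a) =
  (fun m => \sum_(k < a./2.+1) hcoef q a k * shift (d + (a - 2 * k)) (wcoef q) m).
Proof.
apply: funext => m; rewrite {1}/shift /ucoef; case: ifPn => dm.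
  by apply: eq_bigr => k _; rewrite -shift_shift [in RHS]/shift dm.
by rewrite big1 // => k _; rewrite -shift_shift [shift d _ m]/shift (negbTE dm) mulr0.
Qed.

Lemma jackson_ok_gauss_hermite d a : jackson_ok q (shift d (ucoef q a)).
Proof.
by rewrite shift_ucoef; apply: jackson_ok_lin => // k; exact: jackson_ok_w.
Qed.

Lemma jackson_gauss_hermite d a : jackson q (shift d (ucoef q a)) =
  hermite_value q (moment q) a d.
Proof.
rewrite -(hermite_moment_value q01 (moment_rec q01) (moment_odd q01)).
rewrite shift_ucoef jackson_lin // => k; exact: jackson_ok_w.
Qed.

(** The Gaussian is even and $h_a$ has the parity of $a$. *)
Lemma shift_ucoef_parity d a m : odd m != (odd d (+) odd a) -> shift d (ucoef q a) m = 0.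
Proof.
move=> om; rewrite shift_ucoef big1 // => k _; rewrite /shift.
have ka : (2 * k <= a)%N by have := ltn_ord k; lia.
case: ifP => h; rewrite ?mulr0 // wcoef_odd ?mulr0 // oddB // oddD oddB // oddM /= addbF.
by move: om; case: (odd m) (odd d) (odd a) => [] [] [].
Qed.

End GaussHermite.

(** * Integrating out one variable *)

Section GaussianStep.
Variables (R : realType) (n : nat) (q : R).
Hypothesis q01 : 0 < q < 1.
Implicit Types (v : 'I_n -> nat -> R[i]) (beta : 'I_n -> int) (e : expo n).

Let q0 : 0 < q. Proof. by case/andP: q01. Qed.
Let q1 : q < 1. Proof. by case/andP: q01. Qed.
Let qn0 : q != 0. Proof. exact: lt0r_neq0. Qed.

Definition qz (z : int) : R[i] := (q ^ z)%:C.

Lemma qzD a b : qz (a + b) = qz a * qz b.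
Proof. by rewrite /qz expfzDr // rmorphM. Qed.

Lemma qz0 : qz 0 = 1.
Proof. by rewrite /qz expr0z. Qed.

Lemma qzX a k : qz a ^+ k = qz (a * k%:Z).
Proof. by rewrite /qz -rmorphXn exprnP exprz_exp. Qed.

Lemma qz_sum (I : Type) (r : seq I) (F : I -> int) :
  qz (\sum_(i <- r) F i) = \prod_(i <- r) qz (F i).
Proof. exact: (big_morph qz qzD qz0). Qed.

Lemma normc_qz a : normc (qz a) = q ^ a.
Proof. by rewrite normc_real ger0_norm // exprz_ge0 // ltW. Qed.

Definition pair_sum e : nat := (\sum_(i < n) \sum_(j < n | (j < i)%N) e i * e j)%N.

(* The family closed under the lattice integrations: Gaussian cross terms
   [q ^ (e_i e_j)], one coefficient sequence per variable, and a linear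
   exponent [beta] recording the rescalings. *)
Definition gauss_series (K : R[i]) v beta : expo n -> R[i] := fun e =>
  K * (\prod_j v j (e j) * qz ((pair_sum e)%:Z + \sum_j beta j * (e j)%:Z)).

(** The cross factor has modulus at most 1 and the linear factor rescales each $z_j$ by
    $q^{\beta_j}$, so the terms are dominated by a product of one-variable series. *)
Lemma gauss_series_entire K v beta :
  (forall j, entire1 (v j)) -> entire_series (gauss_series K v beta).
Proof.
move=> ev z.
pose a j k : R := normc (v j k) * (q ^ beta j * normc (z 0 j)) ^+ k.
have a0 j k : 0 <= a j k.
  rewrite mulr_ge0 ?normc_ge0 // exprn_ge0 // mulr_ge0 ?normc_ge0 //.
  by rewrite exprz_ge0 // ltW.
have aoo j : (nsum (a j) < +oo)%E.
  have /abs_summableE := ev j (qz (beta j) * z 0 j).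
  congr (_ < +oo)%E; congr nsum; apply: funext => k.
  by rewrite ComplexField.Normc.normcM normcX ComplexField.Normc.normcM normc_qz.
have p0 e : 0 <= \prod_j a j (e j) by apply: prodr_ge0.
have poo := nsum_expo_prod a0 aoo.
apply: (@abs_summable_le _ _ _ (fun e => normc K * \prod_j a j (e j))); last first.
  by rewrite (nsumZ (normc_ge0 K) p0 poo) -(nsum_fin p0 poo) -EFinM ltry.
move=> e; rewrite /series_term /gauss_series.
rewrite !ComplexField.Normc.normcM -mulrA ler_wpM2l ?normc_ge0 //.
rewrite qzD qz_sum ComplexField.Normc.normcM !normc_prod normc_qz.
have -> : \prod_j a j (e j) = \prod_j normc (v j (e j)) *
    \prod_j normc (qz (beta j * (e j)%:Z)) * \prod_j normc (z 0 j ^+ e j).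
  rewrite -!big_split; apply: eq_bigr => j _; rewrite /a exprMn.
  by rewrite -qzX !normcX normc_qz mulrA.
rewrite [leLHS](_ : _ = q ^ (pair_sum e)%:Z * (\prod_j normc (v j (e j)) *
    \prod_j normc (qz (beta j * (e j)%:Z)) * \prod_j normc (z 0 j ^+ e j))); last by ring.
rewrite ler_piMl //.
  by rewrite !mulr_ge0 // prodr_ge0 // => j _; exact: normc_ge0.
by rewrite -exprnP exprn_ile1 // ltW.
Qed.

Lemma even_part_gauss K v beta :
  (forall j m, odd m -> v j m = 0) ->
  even_part (gauss_series K v beta) = gauss_series K v beta.
Proof.
move=> vodd; apply: funext => e; rewrite /even_part; case: ifPn => //.
rewrite negb_forall => /existsP[j]; rewrite negbK => oj.
by rewrite /gauss_series (bigD1 j) //= vodd // !mul0r mulr0.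
Qed.

Section OneStep.
Variables (g : 'I_n -> R) (l : 'I_n) (K : R[i]) (v : 'I_n -> nat -> R[i]).
Variables (beta : 'I_n -> int) (gl t : int).
Hypothesis v_entire : forall j, entire1 (v j).
Hypothesis v_even : forall j m, odd m -> v j m = 0.
Hypothesis vl_ok : jackson_ok q (v l).
Hypothesis gE : g l = q ^ gl.
Hypothesis parity : gl + beta l = 2%:Z * t.

(** Coefficients of the constant series 1, given to a variable that has been integrated out. *)
Definition delta0 (m : nat) : R[i] := (m == 0%N)%:R.

Definition step_v j := if j == l then delta0 else v j.

(** The first unit comes from the factor $q^{-N}$, in which every remaining exponent occurs; the
    second from the coordinates $q^{-1}z_j$, $j<l$, of the lattice point. *)
Definition step_beta (j : 'I_n) : int := beta j - 1 - (j < l)%N%:Z.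

Lemma step_v_entire j : entire1 (step_v j).
Proof.
rewrite /step_v; case: eqP => // _ z.
suff : has_sum (fun m => delta0 m * z ^+ m) (delta0 0 * z ^+ 0) by case.
by apply: (@has_sum1 R nat (fun m => delta0 m * z ^+ m)) => -[|m] // _; rewrite /delta0 mul0r.
Qed.

Lemma step_v_even j m : odd m -> step_v j m = 0.
Proof. by rewrite /step_v; case: eqP => [_|_]; [case: m|exact: v_even]. Qed.

(** The exponent $N$ of the rescaling $V_l(q^Nz_l)$ when the other variables have exponents [e]. *)
Let Nexp e : int := beta l + (\sum_i e i)%N%:Z.

Let shifted (z : 'rV[R[i]]_n) (i : 'I_n) : R[i] := (if (i < l)%N then qz (-1) else 1) * z 0 i.

(** The contribution of the variables other than $z_l$ at a lattice point. The [delta0] in [step_v]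
    confines it to exponents with [e l = 0]. *)
Let T z e : R[i] := gauss_series K step_v beta e * \prod_i shifted z i ^+ e i.

Let T0 z e : e l != 0%N -> T z e = 0.
Proof.
move=> el; rewrite /T /gauss_series (bigD1 l) //= /step_v eqxx /delta0 (negbTE el).
by rewrite !mul0r mulr0 mul0r.
Qed.

(** Each other variable forms exactly one ordered pair with $z_l$, whichever side of [l] its index
    lies on. *)
Let pair_sum_split e : e l = 0%N -> forall m,
  pair_sum (fupd e l m) = (pair_sum e + m * \sum_i e i)%N.
Proof.
move=> el m.
have -> : fupd e l m = fexp l m + e.
  by apply/ffunP => j; rewrite !ffunE; case: eqP => [->|_]; rewrite ?el ?addr0 ?add0r.
rewrite -[pair_sum _]/(twist (fun i j : 'I_n => (j < i)%N) (fexp l m + e) (fexp l m + e)).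
rewrite twistDl !twistDr twist_fexp_same; last by move=> i; rewrite ltnn.
rewrite add0n -[pair_sum e]/(twist (fun i j : 'I_n => (j < i)%N) e e) addnA addnC.
congr addn; rewrite /twist (bigD1 l) //= [X in (_ + X + _)%N]big1 ?addn0; last first.
  by move=> i /negbTE il; apply: big1 => j _; rewrite fexpE il.
rewrite [in RHS](bigID (fun j : 'I_n => (j < l)%N)) /= mulnDr; congr addn.
  by rewrite big_distrr /=; apply: eq_bigr => j _; rewrite fexpE eqxx.
rewrite big_distrr /= [RHS]big_mkcond; apply: eq_bigr => i _.
case: (ltngtP i l) => [il|li|/val_inj il] /=.
- by apply: big1 => j ji; rewrite fexpE; case: eqP => [jl|]; [rewrite jl in ji; lia|rewrite muln0].
- rewrite (bigD1 l) //= fexpE eqxx big1 ?addn0 1?mulnC // => j /andP[_ /negbTE jl].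
  by rewrite fexpE jl muln0.
- by rewrite il el muln0; apply: big1 => j _; rewrite mul0n.
Qed.

(** With $m$ the exponent of $z_l$, the cross factors involving $z_l$ and the linear factor
    $q^{\beta_lm}$ combine to $(q^N)^m$, which is absorbed into the argument of $V_l$. *)
Let term_split z h eps e : series_term (gauss_series K v beta) (lattice_point q g l z h eps) e =
  T z (fupd e l 0) * (v l (e l) *
    (qz (Nexp (fupd e l 0)) * lat q (h, eps) * (g l)%:C) ^+ e l).
Proof.
set e' := fupd e l 0; set m := e l.
have e'l : e' l = 0%N by rewrite ffunE eqxx.
have eE : e = fupd e' l m.
  by apply/ffunP => j; rewrite !ffunE; case: eqP => [->|].
have F1 : \prod_j v j (e j) = v l m * \prod_j step_v j (e' j).
  rewrite (bigD1 l) //= [in RHS](bigD1 l) //= {1}/step_v eqxx e'l /delta0 eqxx mul1r.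
  congr (_ * _); apply: eq_bigr => j /negbTE jl; rewrite /step_v jl /e' ffunE jl //.
have F2 : pair_sum e = (pair_sum e' + m * \sum_i e' i)%N.
  by rewrite {1}eE pair_sum_split.
have F3 : \sum_j beta j * (e j)%:Z = \sum_j beta j * (e' j)%:Z + beta l * m%:Z.
  rewrite (bigD1 l) //= [in RHS](bigD1 l) //= e'l mulr0 add0r addrC.
  by congr (_ + _); apply: eq_bigr => j /negbTE jl; rewrite /e' ffunE jl.
have F4 : \prod_i lattice_point q g l z h eps 0 i ^+ e i =
    (lat q (h, eps) * (g l)%:C) ^+ m * \prod_i shifted z i ^+ e' i.
  rewrite (bigD1 l) //= [in RHS](bigD1 l) //= e'l expr0 mul1r; congr (_ * _).
    by rewrite mxE ltnn eqxx rmorphM.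
  apply: eq_bigr => i /negbTE il; rewrite mxE il /shifted /e' ffunE il.
  by case: ifP => // _; rewrite ?mul1r // /qz exprN1.
have F5 : qz ((pair_sum e)%:Z + \sum_j beta j * (e j)%:Z) =
    qz ((pair_sum e')%:Z + \sum_j beta j * (e' j)%:Z) * qz (Nexp e') ^+ m.
  rewrite qzX -qzD F2 F3 /Nexp; congr qz; rewrite PoszD PoszM mulrDl.
  by rewrite mulrC; ring.
rewrite /series_term /T /gauss_series F1 F4 F5.
rewrite -(mulrA (qz (Nexp e'))) (exprMn _ (qz (Nexp e'))).
set x := (_ * _) ^+ m; set y := qz _ ^+ m; set c := qz _; set b := \prod_i _ ^+ _.
by set a := \prod_j _; ring.
Qed.

Let value_split z h eps :
  has_sum (fun e => T z e * value1 (v l) (qz (Nexp e) * lat q (h, eps) * (g l)%:C))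
    (csum (series_term (gauss_series K v beta) (lattice_point q g l z h eps))).
Proof.
set w := lattice_point q g l z h eps.
pose y e := qz (Nexp e) * lat q (h, eps) * (g l)%:C.
pose U (x : expo n * nat) := T z x.1 * (v l x.2 * y x.1 ^+ x.2).
pose f e : expo n * nat := (fupd e l 0, e l).
have finj : injective f.
  move=> e e' [/ffunP h1 h2]; apply/ffunP => j; have := h1 j; rewrite !ffunE.
  by case: eqP => [->|].
apply: (@has_sum_pair _ _ _ U).
  apply/(has_sum_inj _ finj).
    move=> [e m] he; rewrite /U /=; have [el|el] := eqVneq (e l) 0%N; last first.
      by rewrite T0 ?mul0r.
    have := he (fupd e l m); rewrite /f ffunE eqxx.
    rewrite (_ : fupd _ _ _ = e) ?eqxx //.
    by apply/ffunP => j; rewrite !ffunE; case: eqP => // ->.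
  split.
    have := gauss_series_entire K beta v_entire w.
    by congr abs_summable; apply: funext => e; rewrite term_split.
  by congr csum; apply: funext => e; rewrite term_split.
by move=> e; exact: (has_sumZ (T z e) (value1P (y e) (v_entire l))).
Qed.

(** The part of $q^{-N}$ that does not depend on the exponents. *)
Definition step_K := K * qz (- beta l).

Let Y z e : R[i] := series_term (gauss_series step_K step_v step_beta) z e.

Let YE z e : Y z e = T z e * qz (- Nexp e).
Proof.
rewrite /Y /T /series_term /gauss_series /step_K.
have -> : \prod_i shifted z i ^+ e i =
    qz (- \sum_(i < n) (i < l)%N%:Z * (e i)%:Z) * \prod_i z 0 i ^+ e i.
  rewrite -sumrN qz_sum -big_split; apply: eq_bigr => i _; rewrite /shifted exprMn.
  congr (_ * _); case: (i < l)%N; first by rewrite qzX mul1r mulN1r.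
  by rewrite mul0r oppr0 qz0 expr1n.
have -> : \sum_j step_beta j * (e j)%:Z = \sum_j beta j * (e j)%:Z
    - (\sum_i e i)%N%:Z - \sum_(i < n) (i < l)%N%:Z * (e i)%:Z.
  rewrite (big_morph Posz PoszD (erefl _)) -!sumrB; apply: eq_bigr => j _.
  by rewrite /step_beta; ring.
rewrite /Nexp opprD !qzD; ring.
Qed.

Let Y_odd z e : ~~ [forall j, ~~ odd (e j)] -> T z e = 0.
Proof.
rewrite negb_forall => /existsP[j]; rewrite negbK => oj.
by rewrite /T /gauss_series (bigD1 j) //= step_v_even // !mul0r mulr0 mul0r.
Qed.

(** For even exponents, twice this number is $N$ plus the exponent of $\gamma_l$. *)
Let shift_index e : int := t + ((\sum_i e i)./2)%N%:Z.

(** The double family over exponents and lattice points, with the lattice index already shifted so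
    that each row is a constant times a Jackson sum. *)
Let X z (x : expo n * (int * bool)) : R[i] :=
  Y z x.1 * jackson_term q (v l) (x.2.1 + shift_index x.1, x.2.2).

Let XE z e h eps : X z (e, (h, eps)) = (q ^ (2%:Z * h) * g l)%:C *
  (T z e * value1 (v l) (qz (Nexp e) * lat q (h, eps) * (g l)%:C)).
Proof.
rewrite -[LHS]/(Y z e * jackson_term q (v l) (h + shift_index e, eps)) YE.
(* For an exponent with an odd entry the shifted index does not describe the argument, but [T z e]
   is zero there. *)
have [ev|/Y_odd->] := boolP [forall j, ~~ odd (e j)]; last by rewrite !mul0r mulr0.
have s2 : (\sum_i e i)%N%:Z = 2%:Z * ((\sum_i e i)./2)%N%:Z.
  have : ~~ odd (\sum_i e i) by elim/big_ind: _ => // [x y|i _];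
    [rewrite oddD; case: (odd x) (odd y) => [] []|exact: (forallP ev)].
  lia.
have NE : Nexp e + gl = 2%:Z * shift_index e.
  by rewrite /Nexp /shift_index mulrDr -parity -s2; ring.
have latE : qz (Nexp e) * lat q (h, eps) * (g l)%:C = lat q (h + shift_index e, eps).
  rewrite /lat /qz gE -!rmorphM; congr _%:C.
  rewrite mulrDr -NE !expfzDr //=; ring.
have fE : (q ^ (2%:Z * h) * g l)%:C = qz (- Nexp e) * qz (2%:Z * (h + shift_index e)).
  rewrite /qz gE -rmorphM -!expfzDr //; congr (_ ^ _)%:C.
  by rewrite mulrDr -NE; ring.
rewrite latE fE /jackson_term -[(_, _).1]/(h + shift_index e) -/(qz _); ring.
Qed.

Let X_row z e : has_sum (fun x => X z (e, x)) (Y z e * jackson q (v l)).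
Proof.
pose f (x : int * bool) : int * bool := (x.1 + shift_index e, x.2).
have finj : injective f by move=> [a b] [a' b'] [/addIr -> ->].
suff : has_sum (fun x => jackson_term q (v l) (f x)) (jackson q (v l)).
  by move=> h; exact: (has_sumZ (Y z e) h).
refine (proj1 (has_sum_inj (u := jackson_term q (v l)) _ finj _) (jacksonP q01 vl_ok)).
by move=> [a b] /(_ (a - shift_index e, b)); rewrite /f /= subrK eqxx.
Qed.

Let step_entire k : entire_series (gauss_series k step_v step_beta).
Proof. by apply: gauss_series_entire; exact: step_v_entire. Qed.

(** The absolute Jackson sum is invariant under shifts of the lattice, so each row is bounded by the
    same constant times the modulus of [Y z e], and [Y z] is summable. *)
Let X_summable z : abs_summable (X z).
Proof.
have /abs_summableE Joo := jackson_summable q01 vl_ok.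
have J0 x : 0 <= normc (jackson_term q (v l) x) by exact: normc_ge0.
have /abs_summableE Yoo := step_entire step_K z.
have Y0 e : 0 <= normc (Y z e) by exact: normc_ge0.
set JA := nsum _ in Joo.
apply: (@abs_summable_pair _ _ _ _ (fun e => fine JA * normc (Y z e))); last first.
  by rewrite (nsumZ (fine_ge0 (nsum_ge0 J0)) Y0 Yoo) -(nsum_fin Y0 Yoo) -EFinM ltry.
move=> e; pose f (x : int * bool) : int * bool := (x.1 + shift_index e, x.2).
have finj : injective f by move=> [a b] [a' b'] [/addIr -> ->].
have JAE : JA = nsum (fun x => normc (jackson_term q (v l) (f x))).
  apply: (nsum_inj finj J0) => -[a b] /(_ (a - shift_index e, b)).
  by rewrite /f /= subrK eqxx.
have Jf0 x : 0 <= normc (jackson_term q (v l) (f x)) by exact: normc_ge0.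
have Jfoo : (nsum (fun x => normc (jackson_term q (v l) (f x))) < +oo)%E.
  by rewrite -JAE.
rewrite mulrC EFinM (nsum_fin J0 Joo) -/JA JAE -(nsumZ (Y0 e) Jf0 Jfoo).
by apply: le_nsum => x; rewrite -ComplexField.Normc.normcM.
Qed.

Lemma partial_integral_gauss : is_partial_integral q g l (gauss_series K v beta)
  (gauss_series (K * ((1 - q ^+ 2)%:C * jackson q (v l) * qz (- beta l))) step_v step_beta).
Proof.
split; first exact: step_entire.
(* The integrand is entire, so its sum itself serves as the extended function. *)
exists (fun w => csum (series_term (gauss_series K v beta) w)).
  rewrite even_part_gauss //; left => w _; split => //.
  by apply: gauss_series_entire.
move=> z; exists (csum (X z)).
  (* Summing [X] over the exponents first gives the integrand at each lattice point; summing over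
     the lattice first gives the terms of the new series. *)
  apply: (@has_sum_swap _ _ _ (X z)); first by split => //; exact: X_summable.
  move=> [h eps]; rewrite -[(h, eps).1]/h -[(h, eps).2]/eps.
  apply: eq_has_sum (has_sumZ _ (value_split z h eps)) => e.
  by rewrite XE.
have hX : has_sum (X z) (csum (X z)) by split => //; exact: X_summable.
have h1 := has_sumZ (1 - q ^+ 2)%:C (has_sum_pair hX (X_row z)).
have [_ ->] := h1; congr csum; apply: funext => e.
rewrite /Y /series_term /gauss_series /step_K; ring.
Qed.

End OneStep.

End GaussianStep.

(** * Uniqueness and iteration *)

Section EvenPartValues.
Variables (R : realType) (n : nat).
Implicit Types (c : expo n -> R[i]) (z w : 'rV[R[i]]_n).

Definition flip (eps : {ffun 'I_n -> bool}) z : 'rV[R[i]]_n :=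
  \row_i ((-1) ^+ eps i * z 0 i).

Lemma sum_flip_prod (e : expo n) :
  \sum_(eps : {ffun 'I_n -> bool}) \prod_i ((-1) ^+ eps i) ^+ e i =
  if [forall i, ~~ odd (e i)] then 2 ^+ n else 0 :> R[i].
Proof.
rewrite -(bigA_distr_bigA (fun i (b : bool) => ((-1) ^+ b) ^+ e i : R[i])).
have F i : \sum_(b : bool) ((-1) ^+ b) ^+ e i = if odd (e i) then 0 else 2 :> R[i].
  rewrite big_bool /= expr0 expr1n expr1 -signr_odd; case: (odd (e i)).
    by rewrite expr1 addNr.
  by rewrite expr0.
case: ifPn => [/forallP ev|].
  rewrite (eq_bigr (fun=> 2)) ?prodr_const ?card_ord // => i _.
  by rewrite F (negbTE (ev i)).
rewrite negb_forall => /existsP [j]; rewrite negbK => oj.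
by rewrite (bigD1 j) //= F oj mul0r.
Qed.

(** Averaging over all $2^n$ sign changes of the coordinates kills exactly the monomials with an odd
    exponent. *)
Lemma has_sum_even_part c z : entire_series c ->
  has_sum (series_term (even_part c) z)
    (2 ^- n * \sum_(eps : {ffun 'I_n -> bool}) csum (series_term c (flip eps z))).
Proof.
move=> ec.
have h := has_sumZ (2 ^- n) (@has_sum_big _ _ _ (index_enum {ffun 'I_n -> bool}) predT
  (fun eps => series_term c (flip eps z)) _ (fun eps _ => conj (ec (flip eps z)) erefl)).
apply: eq_has_sum h => e; rewrite /series_term.
transitivity (2 ^- n * \sum_(eps : {ffun 'I_n -> bool})
    (c e * \prod_i z 0 i ^+ e i) * \prod_i ((-1) ^+ eps i) ^+ e i).
  congr (_ * _); apply: eq_bigr => eps _; rewrite -mulrA -big_split; congr (_ * _).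
  by apply: eq_bigr => i _; rewrite mxE exprMn mulrC.
rewrite -mulr_sumr sum_flip_prod /even_part; case: ifP => _; last first.
  by rewrite !mul0r !mulr0.
by rewrite mulrCA mulVf ?mulr1 // expf_neq0 // pnatr_eq0.
Qed.

Lemma even_part_entire c : entire_series c -> entire_series (even_part c).
Proof. by move=> ec z; have [] := has_sum_even_part z ec. Qed.

Lemma even_part_values c c' : entire_series c -> entire_series c' ->
  (forall z, csum (series_term c z) = csum (series_term c' z)) ->
  forall z, csum (series_term (even_part c) z) = csum (series_term (even_part c') z).
Proof.
move=> ec ec' cc' z.
have [_ <-] := has_sum_even_part z ec; have [_ <-] := has_sum_even_part z ec'.
by congr (_ * _); apply: eq_bigr => eps _; rewrite cc'.
Qed.

(** In the case of a proper extension, [G] must agree with the sum wherever the series converges,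
    which here is everywhere. *)
Lemma extended_values_entire c (W : set 'rV[R[i]]_n) G w : entire_series c ->
  extended_values c W G -> W w -> G w = csum (series_term c w).
Proof.
move=> ec [h Ww|[U [[_ _ _ WU _] h]] Ww]; first by have [] := h w Ww.
by have [_] := h w (WU w Ww) (ec w).
Qed.

End EvenPartValues.

Section Uniqueness.
Variables (R : realType) (n : nat) (q : R).
Implicit Types (g : 'I_n -> R) (phi psi : expo n -> R[i]).

(** Values rather than coefficients are compared, since a partial integral prescribes [psi] only
    through its sums. *)
Lemma partial_integral_values g l phi phi' psi psi' :
  entire_series phi -> entire_series phi' ->
  (forall z, csum (series_term phi z) = csum (series_term phi' z)) ->
  is_partial_integral q g l phi psi -> is_partial_integral q g l phi' psi' ->
  forall z, csum (series_term psi z) = csum (series_term psi' z).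
Proof.
move=> ep ep' pp' [_ [G GE Gs]] [_ [G' GE' Gs']] z.
have [t ht ->] := Gs z; have [t' ht' ->] := Gs' z; congr (_ * _).
apply: has_sum_unique ht _; apply: eq_has_sum ht' => x; congr (_ * _).
have W : [set w | exists z h eps, w = lattice_point q g l z h eps]%classic
    (lattice_point q g l z x.1 x.2) by exists z, x.1, x.2.
rewrite (extended_values_entire (even_part_entire ep') GE' W).
rewrite (extended_values_entire (even_part_entire ep) GE W).
exact/esym/even_part_values.
Qed.

Lemma lattice_integral_unique (s : 'S_n) g (f : qA q n) v v' : (0 < n)%N ->
  entire_series f -> is_lattice_integral s g f v -> is_lattice_integral s g f v' ->
  v = v'.
Proof.
move=> n0 ef [_ [phi [p0 pS pz ->]]] [_ [phi' [p0' pS' pz' ->]]].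
have H k : (k <= n)%N -> [/\ entire_series (phi k), entire_series (phi' k) &
    forall z, csum (series_term (phi k) z) = csum (series_term (phi' k) z)].
  elim: k => [_|k IH kn]; first by rewrite p0 p0'; split.
  have [e1 e2 e3] := IH (ltnW kn).
  have h := pS (Ordinal kn); have h' := pS' (Ordinal kn).
  split; [by case: h|by case: h'|].
  exact: partial_integral_values e1 e2 e3 h h'.
have [_ _ /(_ 0)] := H n (leqnn n).
(* After the last integration all coefficients but the constant one vanish, so the constant one is
   recovered as the value at 0. *)
have V (ph : nat -> expo n -> R[i]) : (forall (k : 'I_n) (e : expo n),
    (exists2 j : 'I_n, (j <= k)%N & e (s j) != 0%N) -> ph k.+1 e = 0) ->
    csum (series_term (ph n) 0) = ph n 0.
  move=> hz; have -> : ph n 0 = series_term (ph n) 0 0.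
    by rewrite /series_term big1 ?mulr1 // => i _; rewrite ffunE expr0.
  apply/esym; apply: (proj2 (has_sum1 _)) => e e0.
  have [i ei] : exists i, e i != 0%N.
    apply/existsP; apply: contraR e0; rewrite negb_exists => /forallP h.
    by apply/eqP/ffunP => i; rewrite ffunE; apply/eqP; have := h i; rewrite negbK.
  have k1 : (n.-1 < n)%N by rewrite prednK.
  have := hz (Ordinal k1) e; rewrite /= prednK // /series_term => ->; first by rewrite mul0r.
  exists ((s^-1)%g i); last by rewrite permKV.
  by rewrite /= -ltnS prednK.
by rewrite !V.
Qed.

Lemma lattice_integralE (s : 'S_n) g (f : qA q n) v : (0 < n)%N ->
  entire_series f -> is_lattice_integral s g f v -> lattice_integral s g f = v.
Proof.
move=> n0 ef fv; apply: xget_subset1 => // x y; exact: lattice_integral_unique.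
Qed.

Lemma entire_convergent (f : expo n -> R[i]) : entire_series f -> convergent_near0 f.
Proof. by move=> ef; exists 1. Qed.

Lemma lattice_integral_odd (s : 'S_n) g (f : qA q n) : (0 < n)%N ->
  entire_series f -> even_part f = (fun=> 0) -> is_lattice_integral s g f 0.
Proof.
move=> n0 ef ev; split; first exact: entire_convergent.
pose zero : expo n -> R[i] := fun=> 0.
have zs z : has_sum (series_term zero z) 0.
  by apply: eq_has_sum (@has_sum0 R _) => e; rewrite /series_term mul0r.
exists (fun k => if k == 0%N then (f : expo n -> R[i]) else zero); split => //.
  move=> k; split; first by move=> z; have [] := zs z.
  exists (fun=> 0).
    left=> w _; rewrite (_ : even_part _ = zero) //.
    case: ifP => // _.
    by apply: funext => e; rewrite /even_part if_same.
  move=> z; exists 0; last by have [_ <-] := zs z; rewrite mulr0.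
  by apply: eq_has_sum (@has_sum0 R _) => x; rewrite mulr0.
by rewrite gtn_eqF.
Qed.

End Uniqueness.

(** * All integrations in the order given by the permutation *)

Section IteratedIntegral.
Variables (R : realType) (n : nat) (q : R).
Hypothesis q01 : 0 < q < 1.
Variables (s : 'S_n) (g : 'I_n -> R) (v : 'I_n -> nat -> R[i]).
Variables (beta gx : 'I_n -> int).
Hypothesis v_even : forall j m, odd m -> v j m = 0.
Hypothesis v_ok : forall j, jackson_ok q (v j).
Hypothesis gE : forall k, g (s k) = q ^ gx k.

(* How often [z_j] has been scaled by [q^-1] after [k] integrations: once by the
   factor [q^(-N)], and once more by the point [w] when [j < s i]. *)
Definition scale_count (k : nat) (j : 'I_n) : nat :=
  (\sum_(i < n | (i < k)%N) (1 + (j < s i)))%N.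

Hypothesis parity : forall k : 'I_n,
  exists t : int, gx k + (beta (s k) - (scale_count k (s k))%:Z) = 2%:Z * t.

(** With [ibeta] and [iK], the data of the Gaussian family after [k] integrations. *)
Let iv k j := if [exists i : 'I_n, (i < k)%N && (s i == j)] then @delta0 R else v j.

Let ibeta k (j : 'I_n) : int := beta j - (scale_count k j)%:Z.

Let iK k : R[i] := \prod_(i < n | (i < k)%N)
  ((1 - q ^+ 2)%:C * jackson q (v (s i)) * qz q (- ibeta i (s i))).

Let iphi k : expo n -> R[i] := gauss_series q (iK k) (iv k) (ibeta k).

Let iv_entire k j : entire1 (iv k j).
Proof.
rewrite /iv; case: ifP => _; last by case: (v_ok j).
have := @step_v_entire R n j v (fun i => (v_ok i).1) j.
by rewrite /step_v eqxx.
Qed.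

Let iv_even k j m : odd m -> iv k j m = 0.
Proof. by rewrite /iv; case: ifP => _; [case: m|exact: v_even]. Qed.

Let iv_cur (k : 'I_n) : iv k (s k) = v (s k).
Proof.
rewrite /iv ifF //; apply/negbTE; rewrite negb_exists; apply/forallP => i.
by rewrite negb_and (inj_eq perm_inj) -leqNgt; case: ltngtP => //= ki; apply/eqP => ik;
  rewrite ik ltnn in ki.
Qed.

Let iK_value : iK n = (1 - q ^+ 2)%:C ^+ n * \prod_j jackson q (v j) *
  qz q (- \sum_j beta j) * qz q (\sum_(k < n) scale_count k (s k))%N%:Z.
Proof.
have -> : iK n = \prod_(i < n)
    ((1 - q ^+ 2)%:C * jackson q (v (s i)) * qz q (- ibeta i (s i))).
  by apply: eq_bigl => i; exact: ltn_ord.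
rewrite !big_split /= prodr_const card_ord.
have -> : \prod_(i < n) jackson q (v (s i)) = \prod_j jackson q (v j).
  by rewrite [RHS](reindex_inj (@perm_inj _ s)).
rewrite -[RHS]mulrA -qzD // -qz_sum //; congr (_ * qz q _).
have -> : \sum_j beta j = \sum_(i < n) beta (s i).
  by rewrite [LHS](reindex_inj (@perm_inj _ s)).
rewrite (big_morph Posz PoszD (erefl _)) -sumrN -big_split.
by apply: eq_bigr => i _; rewrite /ibeta opprB addrC.
Qed.

(** Each application of [partial_integral_gauss] carries [iphi k] to [iphi k.+1]; at the end only
    the accumulated constant [iK n] remains. *)
Lemma gauss_lattice_integral :
  is_lattice_integral s g (gauss_series q 1 v beta : qA q n)
    ((1 - q ^+ 2)%:C ^+ n * \prod_j jackson q (v j) *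
     qz q (- \sum_j beta j) * qz q (\sum_(k < n) scale_count k (s k))%N%:Z).
Proof.
rewrite -iK_value; split.
  by apply: entire_convergent; apply: gauss_series_entire => // j; case: (v_ok j).
exists iphi; split.
- rewrite /iphi; congr (gauss_series q _ _ _).
  + by rewrite /iK big_pred0.
  + apply: funext => j; rewrite /iv ifF //; apply/negbTE.
    by rewrite negb_exists; apply/forallP => i.
  + by apply: funext => j; rewrite /ibeta /scale_count big_pred0 // subr0.
- move=> k; have [t ht] := parity k.
  have := @partial_integral_gauss R n q q01 g (s k) (iK k) (iv k) (ibeta k) (gx k) t
    (iv_entire k) (@iv_even k) _ (gE k) ht.
  rewrite iv_cur => /(_ (v_ok (s k))); congr is_partial_integral.
  rewrite /iphi; congr (gauss_series q _ _ _).
  + rewrite /iK (big_ord_ltS _ _ (ltn_ord k)) mulrC /=.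
    by congr (_ * _); rewrite (_ : Ordinal _ = k) //; exact: val_inj.
  + apply: funext => j; rewrite /step_v /iv; case: eqP => [->|/eqP jk].
      by rewrite ifT //; apply/existsP; exists k; rewrite ltnSn eqxx.
    have kj : (s k == j) = false by rewrite eq_sym (negbTE jk).
    congr (if _ then _ else _); apply: eq_existsb => i; rewrite ltnS.
    by case: (ltngtP i k) => [||/val_inj ->] //=; rewrite kj.
  + apply: funext => j; rewrite /step_beta /ibeta /scale_count.
    rewrite (big_ord_ltS _ _ (ltn_ord k)) /= (_ : Ordinal _ = k); last exact: val_inj.
    by rewrite !PoszD; ring.
- move=> k e [j jk ej]; rewrite /iphi /gauss_series (bigD1 (s j)) //=.
  rewrite {1}/iv ifT; last by apply/existsP; exists j; rewrite ltnS jk eqxx.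
  by rewrite /delta0 (negbTE ej) !mul0r mulr0.
- rewrite /iphi /gauss_series big1 => [|j _]; last first.
    rewrite /iv ifT ?ffunE ?eqxx //; apply/existsP; exists ((s^-1)%g j).
    by rewrite ltn_ord permKV eqxx.
  rewrite mul1r (_ : _ + _ = 0) ?qz0 ?mulr1 //.
  rewrite [X in _ + X]big1 => [|j _]; last by rewrite ffunE mulr0.
  by rewrite addr0 /pair_sum big1 // => i _; apply: big1 => j _; rewrite ffunE mul0n.
Qed.

End IteratedIntegral.

(** * Matching the coefficients of the transform *)

Section Coefficients.
Variables (R : realType) (n : nat) (q : R).
Hypothesis q01 : 0 < q < 1.
Implicit Types (a : 'I_n -> nat) (d e : expo n).

Lemma qz_nat k : qz q k%:Z = q%:C ^+ k.
Proof. by rewrite /qz rmorphXn. Qed.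

(** Normal ordering at exponent $m$ costs the twist of $m-d$ with $m$. This is the pair sum of $m$
    minus a term linear in $m$, and the linear term gives $\beta_j=-\sum_{i>j}d_i$. *)
Lemma gauss_hermite_mono a d :
  (\prod_(j < n) single (rev_ord j) (ucoef q (a (rev_ord j))) * mono d : qA q n) =
  gauss_series q 1 (fun j => shift (d j) (ucoef q (a j)))
    (fun j => - (\sum_(i < n | (j < i)%N) d i)%N%:Z).
Proof.
apply: funext => m; rewrite mul_monoE (prod_single_qA q (fun j => ucoef q (a j))).
rewrite /gauss_series mul1r.
case: ifPn => [dm|]; last first.
  rewrite negb_forall => /existsP [j]; rewrite -ltnNge => jm.
  by rewrite (bigD1 j) //= /shift leqNgt jm !mul0r.
rewrite mulrA mulrC; congr (_ * _).
  by apply: eq_bigr => j _; rewrite /shift (forallP dm) ffunE.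
set b := (fun i j : 'I_n => (j < i)%N).
rewrite -[(\sum_(i < n) _)%N]/(twist b (fsub m d) (fsub m d)) -exprD.
rewrite -[pair_sum m]/(twist b m m).
have -> : \sum_(j < n) - (\sum_(i < n | (j < i)%N) d i)%N%:Z * (m j)%:Z = - (twist b d m)%:Z.
  rewrite (eq_bigr (fun j : 'I_n => - (\sum_(i < n | (j < i)%N) d i * m j)%N%:Z)); last first.
    by move=> j _; rewrite mulNr -PoszM big_distrl.
  rewrite sumrN -(big_morph Posz PoszD (erefl _)) /twist; congr (- (Posz _)).
  by rewrite (exchange_big_dep predT).
have -> : (twist b m m)%:Z - (twist b d m)%:Z = (twist b (fsub m d) m)%:Z.
  by rewrite -{1}(fsubK dm) twistDl PoszD addrC addKr.
rewrite qz_nat; congr (_ ^+ _).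
by rewrite -(twistDr b (fsub m d) d (fsub m d)) fsubK.
Qed.

Lemma gauss_sum_series :
  (fun e => q%:C ^+ (\sum_(i < n) \sum_(j < n | (j < i)%N) e i * e j)%N
            * \prod_j wcoef q (e j)) =
  gauss_series q 1 (fun _ : 'I_n => wcoef q) (fun=> 0).
Proof.
apply: funext => e; rewrite /gauss_series mul1r mulrC; congr (_ * _).
by rewrite [X in qz q (_ + X)]big1 ?addr0 ?qz_nat // => j _; rewrite mul0r.
Qed.

(** This is the part of the exponent of $\gamma_{\sigma(k)}$ other than $A^{\sigma(k)}$, with [k]
    counted from 0; the prescribed $\gamma$ thus compensates the accumulated scalings. *)
Lemma scale_countE (s : 'S_n) (k : 'I_n) :
  scale_count s k (s k) = (k + #|[set j : 'I_n | (j < k)%N && (s k < s j)%N]|)%N.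
Proof.
rewrite /scale_count big_split /=; congr addn.
  rewrite -(big_ord_widen n (fun=> 1%N)) ?(ltnW (ltn_ord k)) //.
  by rewrite sum1_card card_ord.
rewrite -sum1_card big_mkcond [RHS]big_mkcond /=; apply: eq_bigr => j _.
by rewrite inE; case: (j < k)%N; case: (s k < s j)%N.
Qed.

(** Identifies the exponent $-\sum_j\beta_j$ from the integrations with the one cancelled by
    $q^{-\sum_j(j-1)e_j}$ in the weak transform. *)
Lemma sum_tail_weight d :
  (\sum_(j < n) \sum_(i < n | (j < i)%N) d i = \sum_(i < n) i * d i)%N.
Proof.
rewrite (exchange_big_dep predT) //=; apply: eq_bigr => i _.
rewrite -(big_ord_widen n (fun=> d i)) ?(ltnW (ltn_ord i)) //.
by rewrite sum_nat_const card_ord.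
Qed.

(** For $d-a$ even, $i^d=i^a(-1)^{(d-a)/2}$; the sign is the one that turns the Hermite moment into
    a coefficient of $\partial^a e_{q^4}(-\partial^2)$. *)
Lemma hermite_value_dcoef (M0 : nat -> R[i]) (a0 d0 : nat) :
  hermite_value q M0 a0 d0 * 'i%C ^+ d0 =
  'i%C ^+ a0 * q%:C ^+ (a0 ^ 2 - a0) * M0 0%N *
  shift a0 (dcoef q) d0 * qpoch (q%:C ^+ 2) (q%:C ^+ 2) d0.
Proof.
rewrite /hermite_value /shift; case: (leqP a0 d0) => ad /=; last by rewrite !mulr0 !mul0r.
rewrite /dcoef; case: (boolP (odd (d0 - a0))) => [od|ev] /=; first by rewrite !mulr0 !mul0r.
have -> : (2 * 'C(a0, 2) = a0 ^ 2 - a0)%N.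
  rewrite bin2 mul2n even_halfK; last by case: a0 {ad ev} => // m; rewrite oddM /= andNb.
  by rewrite -mulnn; case: a0 {ad ev} => // m /=; lia.
have -> : 'i%C ^+ d0 = 'i%C ^+ a0 * (-1) ^+ (d0 - a0)./2 :> R[i].
  rewrite -{1}(subnKC ad) exprD -{1}(even_halfK ev) -mul2n exprM; congr (_ * _ ^+ _).
  exact: sqr_i.
rewrite /e_coef; ring.
Qed.

End Coefficients.

Theorem mainTheorem4 (R : realType) (n : nat) (q : R) (a : 'I_n -> nat)
    (s : 'S_n) (gam : 'I_n -> R) :
  (0 < n)%N -> 0 < q < 1 ->
  (forall k : 'I_n, gam (s k) =
     q ^+ (k + \sum_(j < n | (s k < j)%N) a j
             + #|[set j : 'I_n | (j < k)%N && (s k < s j)%N]|)%N) ->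
  let gamt := fun k : 'I_n => q ^+ (\sum_(j < n | (k < j)%N) a j)%N * gam k in
  let q4 : R[i] := q%:C ^+ 4 in
  let x := (fun j : 'I_n => gen j) : 'I_n -> qA q n in
  let d := (fun j : 'I_n => gen j) : 'I_n -> qD q n in
  let f : qA q n :=
    \prod_(j < n) (series_at (E_coef q4) (- (q4 *: x (rev_ord j) ^+ 2))
                   * dHermite q%:C (a (rev_ord j)) (x (rev_ord j))) in
  let g : qA q n := series_at (E_coef q4) (- (q4 *: \sum_(j < n) x j ^+ 2)) in
  [/\ weak_transformable s gam f,
      lattice_integrable s gamt g &
      weak_transform s gam f =
        ('i%C ^+ (\sum_(j < n) a j)%N * q%:C ^+ (\sum_(j < n) (a j ^ 2 - a j))%N
           * lattice_integral s gamt g)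
        *: \prod_(j < n) (d (rev_ord j) ^+ a (rev_ord j)
                          * series_at (e_coef q4) (- d (rev_ord j) ^+ 2))].
Proof.
move=> n0 q01 gamE gamt q4 x d f g.
have fE : f = \prod_(j < n) single (rev_ord j) (ucoef q (a (rev_ord j))).
  by apply: eq_bigr => j _; exact: gauss_hermite_single.
have gE : g = gauss_series q 1 (fun _ : 'I_n => wcoef q) (fun=> 0) :> (expo n -> R[i]).
  by rewrite -gauss_sum_series; apply: funext => e; exact: gauss_sum_coef.
(* The constant common to the integral of the Gaussian and to all Fourier coefficients. *)
pose C0 := (1 - q ^+ 2)%:C ^+ n * qz q (\sum_(k < n) scale_count s k (s k))%N%:Z.
have w_ok : jackson_ok q (wcoef q).
  have := jackson_ok_w q01 0; congr jackson_ok; apply: funext => m.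
  by rewrite /shift leq0n subn0.
have w_even (m : nat) : odd m -> wcoef q m = 0 by exact: wcoef_odd.
have Ig : is_lattice_integral s gamt g (C0 * moment q 0 ^+ n).
  pose gx (k : 'I_n) : int :=
    (\sum_(j < n | (s k < j)%N) a j + (k + \sum_(j < n | (s k < j)%N) a j
       + #|[set j : 'I_n | (j < k)%N && (s k < s j)%N]|))%N.
  have gxE k : gamt (s k) = q ^ gx k by rewrite /gamt gamE -exprD.
  (* The tail sum occurs twice in [gamt], once from [gam] and once from the rescaling; the remaining
     exponent is cancelled by [scale_count]. *)
  have par (k : 'I_n) : exists t : int,
      gx k + (0 - (scale_count s k (s k))%:Z) = 2%:Z * t.
    exists (\sum_(j < n | (s k < j)%N) a j)%N%:Z.
    by rewrite scale_countE /gx !PoszD; ring.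
  have := gauss_lattice_integral q01 (v := fun=> wcoef q) (beta := fun=> 0) (fun _ => w_even)
    (fun=> w_ok) gxE par.
  rewrite -[X in is_lattice_integral s gamt X]gE; congr is_lattice_integral.
  rewrite /= prodr_const card_ord big1 // oppr0 qz0 /C0.
  have -> : jackson q (wcoef q) = moment q 0.
    rewrite /moment; congr jackson; apply: funext => m.
    by rewrite /shift leq0n subn0.
  ring.
have g_entire : entire_series g.
  by rewrite gE; apply: gauss_series_entire => // j; case: w_ok.
have If (e : expo n) : entire_series (f * \prod_(j < n) gen j ^+ e j) /\
    is_lattice_integral s gam (f * \prod_(j < n) gen j ^+ e j)
    (C0 * \prod_j hermite_value q (moment q) (a j) (e j) *
     q%:C ^+ (\sum_(j < n) j * e j)%N).
  rewrite qA_normal fE gauss_hermite_mono //.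
  set v := fun j : 'I_n => shift (e j) (ucoef q (a j)).
  set beta := fun j : 'I_n => - (\sum_(i < n | (j < i)%N) e i)%N%:Z.
  have v_ok j : jackson_ok q (v j) by exact: jackson_ok_gauss_hermite.
  have ent : entire_series (gauss_series q 1 v beta).
    by apply: gauss_series_entire => // j; case: (v_ok j).
  split => //.
  (* If some [e j] and [a j] differ in parity, the series in $z_j$ is odd: the even part is zero and
     so is the corresponding [hermite_value]. *)
  have [/forallP ev|] := boolP [forall j, odd (e j) == odd (a j)]; last first.
    rewrite negb_forall => /existsP [j nj].
    have -> : \prod_j hermite_value q (moment q) (a j) (e j) = 0.
      rewrite (bigD1 j) //= {1}/hermite_value.
      case: leqP => //= ae; rewrite ?mul0r // oddB //.
      by move: nj; case: (odd (e j)) (odd (a j)) => [] [] //= _; rewrite mul0r.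
    rewrite mulr0 mul0r; apply: lattice_integral_odd => //.
    apply: funext => m; rewrite /even_part; case: ifP => // /forallP em.
    rewrite /gauss_series (bigD1 j) //= {1}/v shift_ucoef_parity ?mul0r ?mulr0 //.
    by rewrite (negbTE (em j)); move: nj; case: (odd (e j)) (odd (a j)) => [] [].
  have v_even j m : odd m -> v j m = 0.
    by move=> om; rewrite /v shift_ucoef_parity // om (eqP (ev j)) addbb.
  pose gx (k : 'I_n) : int := (k + \sum_(j < n | (s k < j)%N) a j
       + #|[set j : 'I_n | (j < k)%N && (s k < s j)%N]|)%N.
  have gxE k : gam (s k) = q ^ gx k by rewrite gamE.
  have par (k : 'I_n) : exists t : int,
      gx k + (beta (s k) - (scale_count s k (s k))%:Z) = 2%:Z * t.
    (* What is left is the sum of $a_j-e_j$ over $j>\sigma(k)$, each summand being even. *)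
    rewrite scale_countE /gx /beta.
    have [u Hu] : exists u : int, (\sum_(j < n | (s k < j)%N) a j)%N%:Z -
        (\sum_(i < n | (s k < i)%N) e i)%N%:Z = 2%:Z * u.
      rewrite !(big_morph Posz PoszD (erefl _)) -sumrB.
      elim/big_ind: _ => [|y z [u ->] [u' ->]|j _]; first by exists 0; rewrite mulr0.
        by exists (u + u'); rewrite mulrDr.
      exists ((a j)./2%:Z - (e j)./2%:Z).
      by have := eqP (ev j); have := odd_double_half (a j); have := odd_double_half (e j); lia.
    by exists u; rewrite -Hu !PoszD; ring.
  have := gauss_lattice_integral q01 v_even v_ok gxE par.
  congr is_lattice_integral.
  rewrite /beta sumrN opprK -(big_morph Posz PoszD (erefl _)) sum_tail_weight qz_nat.
  rewrite (eq_bigr (fun j => hermite_value q (moment q) (a j) (e j))) /C0; last first.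
    by move=> j _; exact: jackson_gauss_hermite.
  ring.
split.
- by move=> e; exists (C0 * \prod_j hermite_value q (moment q) (a j) (e j) *
     q%:C ^+ (\sum_(j < n) j * e j)%N); case: (If e).
- by exists (C0 * moment q 0 ^+ n).
rewrite (lattice_integralE n0 g_entire Ig).
have dE : \prod_(j < n) (d (rev_ord j) ^+ a (rev_ord j)
    * series_at (e_coef q4) (- d (rev_ord j) ^+ 2)) =
    \prod_(j < n) single (rev_ord j) (shift (a (rev_ord j)) (dcoef q)).
  by apply: eq_bigr => j _; exact: derivative_single.
rewrite dE; apply: funext => e.
rewrite -[RHS]/(_ * _) (prod_single_qD q (fun j => shift (a j) (dcoef q))).
rewrite /weak_transform; have [ent /(lattice_integralE n0 ent) ->] := If e.
have p0 : q%:C ^+ (\sum_(j < n) j * e j)%N != 0 by rewrite expf_neq0 // p_neq0.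
have D0 : \prod_(j < n) qpoch (q%:C ^+ 2) (q%:C ^+ 2) (e j) != 0.
  by apply/prodf_neq0 => j _; exact: qpoch_neq0.
have key : \prod_j hermite_value q (moment q) (a j) (e j) * 'i%C ^+ expo_deg e =
    'i%C ^+ (\sum_(j < n) a j)%N * q%:C ^+ (\sum_(j < n) (a j ^ 2 - a j))%N *
    moment q 0 ^+ n * \prod_j shift (a j) (dcoef q) (e j) *
    \prod_(j < n) qpoch (q%:C ^+ 2) (q%:C ^+ 2) (e j).
  have -> : moment q 0 ^+ n = \prod_(j < n) moment q 0 by rewrite prodr_const card_ord.
  rewrite /expo_deg !expr_sum -!big_split.
  by apply: eq_bigr => j _; exact: hermite_value_dcoef.
move: key p0 D0; set N := q%:C ^+ (\sum_(j < n) j * e j)%N; set H := \prod_j hermite_value _ _ _ _.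
set D := \prod_(j < n) qpoch _ _ _; move=> key p0 D0.
(* The power [N] produced by the integrations cancels against its inverse in the definition of the
   transform. *)
rewrite (_ : C0 * H * N * _ = C0 * (H * 'i%C ^+ expo_deg e) / D); last first.
  by field; rewrite D0 p0.
by rewrite key; field.
Qed.
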